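(* Let $P$ be a nice polygon with vertices $A_0,\dots,A_{n-1}$ (indices taken modulo $n$) and center $O$, and let $f\colon P\to\mathbb{R}$ be convex on every triangle $OA_kA_{k+1}$, $k=0,\dots,n-1$. Then $$\operatorname{Avg}(f,P)\le\frac13f(O)+\frac23\cdot\frac1n\sum_{k=0}^{n-1}\operatorname{Avg}(f,A_kA_{k+1}),$$ $$\operatorname{Avg}(f,P)\le\frac13\cdot\frac1n\sum_{k=0}^{n-1}f(A_k)+\frac23\cdot\frac1n\sum_{k=0}^{n-1}\operatorname{Avg}(f,OA_k),$$ $$\operatorname{Avg}(f,P)\le\frac13f(O)+\frac23\cdot\frac1n\sum_{k=0}^{n-1}f(A_k).$$ If moreover $A_k'=h_O^{2/3}(A_k)$ for $k=0,\dots,n-1$, then $$\frac1n\sum_{k=0}^{n-1}\operatorname{Avg}(f,A_k'A_{k+1}')\le\operatorname{Avg}(f,P).$$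
   Context: A nice polygon is a star-shaped polygon $P$ with vertices $A_0,\dots,A_{n-1}$ for which there exists a point $O$ (called its center) in the kernel of $P$ such that all triangles $OA_kA_{k+1}$, $k=0,\dots,n-1$ (indices mod $n$), have the same area. $h_{\mathbf a}^\lambda(\mathbf x)=\mathbf a+\lambda(\mathbf x-\mathbf a)$ is the homothety with center $\mathbf a$ and ratio $\lambda$. For a set $U$ which is a $k$-dimensional object and an integrable $f$, $\operatorname{Avg}(f,U)=\frac{1}{\operatorname{Vol}_k(U)}\int_U f$, with $\operatorname{Vol}_k$ the $k$-dimensional measure (length, area); $\operatorname{Avg}(f,XY)$ denotes the average over the segment $XY$ with respect to length. *)

(* Defs.v *)
From mathcomp Require Import all_boot all_order all_algebra.
From mathcomp Require Import all_classical all_reals all_analysis.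
Set Implicit Arguments. Unset Strict Implicit. Unset Printing Implicit Defensive.
Import Order.TTheory GRing.Theory Num.Theory numFieldNormedType.Exports.
Local Open Scope classical_set_scope.
Local Open Scope ring_scope.

Section Defs.
Variable R : realType.
Local Notation pt := (R * R)%type.

Definition lerp (X Y : pt) (t : R) : pt :=
  (X.1 + t * (Y.1 - X.1), X.2 + t * (Y.2 - X.2)).

Definition homothety (a : pt) (lam : R) (x : pt) : pt :=
  (a.1 + lam * (x.1 - a.1), a.2 + lam * (x.2 - a.2)).

Definition seg (X Y : pt) : set pt := [set lerp X Y t | t in `[0, 1]%classic].

Definition tri (X Y Z : pt) : set pt :=
  [set p | exists a b c : R, [/\ 0 <= a, 0 <= b, 0 <= c, a + b + c = 1 &
      p = (a * X.1 + b * Y.1 + c * Z.1, a * X.2 + b * Y.2 + c * Z.2)]].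

Definition tri_area (X Y Z : pt) : R :=
  `|(Y.1 - X.1) * (Z.2 - X.2) - (Y.2 - X.2) * (Z.1 - X.1)| / 2.

Definition convex_on (S : set pt) (f : pt -> R) : Prop :=
  forall x y, S x -> S y -> forall t : R, 0 <= t <= 1 ->
    f (lerp x y t) <= (1 - t) * f x + t * f y.

Definition bdry (S : set pt) : set pt := closure S `\` interior S.

Definition poly_curve n (A : 'I_n -> pt) : set pt :=
  \bigcup_(k in [set: 'I_n]) seg (A k) (A (ordS k)).

Definition simple_closed n (A : 'I_n -> pt) : Prop :=
  (3 <= n)%N /\
  forall i j : 'I_n, i != j -> forall x,
    seg (A i) (A (ordS i)) x -> seg (A j) (A (ordS j)) x ->
    (j = ordS i /\ x = A j) \/ (i = ordS j /\ x = A i).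

(* P is the (closed) polygonal region bounded by the simple polygon A:
   the unique compact set with nonempty interior whose boundary is the curve *)
Definition polygon_region n (A : 'I_n -> pt) (P : set pt) : Prop :=
  simple_closed A /\ compact P /\ interior P !=set0 /\ bdry P = poly_curve A.

Definition in_kernel (P : set pt) (O : pt) : Prop :=
  P O /\ forall x, P x -> seg O x `<=` P.

Definition nice_polygon n (A : 'I_n -> pt) (P : set pt) (O : pt) : Prop :=
  polygon_region A P /\ in_kernel P O /\
  forall i j : 'I_n, tri_area O (A i) (A (ordS i)) = tri_area O (A j) (A (ordS j)).

Definition leb2 := ((@lebesgue_measure R) \x (@lebesgue_measure R))%E.

Definition avg2 (f : pt -> R) (U : set pt) : R :=
  Rintegral leb2 U f / fine (leb2 U).

(* average over the segment XY w.r.t. length, written via the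
   constant-speed parametrization t |-> X + t (Y - X), t in [0,1] *)
Definition avg_seg (f : pt -> R) (X Y : pt) : R :=
  Rintegral (@lebesgue_measure R) `[0, 1]%classic (fun t => f (lerp X Y t)).
End Defs.

(* Main.v *)
Require Import Defs.
From HB Require Import structures.
From mathcomp Require Import all_boot all_order all_algebra.
From mathcomp Require Import all_classical all_reals all_analysis.
From mathcomp Require Import measurable_realfun ring lra.
Import Order.TTheory GRing.Theory Num.Theory numFieldNormedType.Exports.
Local Open Scope classical_set_scope.
Local Open Scope ring_scope.
Set Implicit Arguments. Unset Strict Implicit. Unset Printing Implicit Defensive.

(** Since [P] is compact and star-shaped about [O], every ray from [O] leaves
    [P] through a boundary point. If some triangle [O A_k A_(k+1)] were
    degenerate, all of them would be, and the boundary would lie on finitely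
    many lines through [O], although [P] contains a disc. As no edge line
    passes through [O], no radial segment lies on the boundary, so each ray
    meets the boundary exactly once; hence [P] minus [O] is the disjoint union
    of the half-open triangles, and [Avg(f, P)] is the mean of the averages
    over the triangles, which have equal areas.

    On a triangle [X Y Z], the polar coordinates [p = X + w (Q_t - X)], with
    [Q_t] running over the edge [Y Z] and [0 <= w <= 1], have Jacobian
    proportional to [w]. Bounding [f p] above by [(1 - w) f(X) + w f(Q_t)], or
    below by Jensen's inequality for the density [2 w] of mean [2/3], and
    integrating over [w] gives
      [Avg(f, Y' Z') <= Avg(f, X Y Z) <= f(X) / 3 + 2/3 Avg(f, Y Z)].
    The apex [X = O] gives the first and last inequalities, averaging the
    upper bounds for the two other choices of apex gives the second one, and
    the third one follows from the first. *)

(** * Linear and polar changes of variables in the plane *)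

Section affine1.
Context {R : realType}.
Local Notation mu := (@lebesgue_measure R).

Let aff (a b : R) (x : R) : measurableTypeR R := a * x + b.

Lemma measurable_affine (D : set R) (a b : R) : measurable_fun D (fun x : R => a * x + b).
Proof. by apply: measurable_funD => //; apply: measurable_funM. Qed.

(** Lebesgue measure is determined by its values on half-open intervals, so it is enough to compare
    it there with the pushforward scaled by [|a|]. *)
Lemma lebesgue_measure_affine (a b : R) (A : set R) : a != 0 -> measurable A ->
  (mu A = `|a|%:E * mu ((fun x => a * x + b)%R @^-1` A))%E.
Proof.
move=> a0 mA.
have mf : measurable_fun setT (aff a b) by exact: measurable_affine.
pose nu := mscale (NngNum (normr_ge0 a)) (pushforward mu (aff a b)).
have -> // := @lebesgue_measure_unique R (nu mf) _ A mA.
move=> _ [[c d]] _ <-; rewrite -[RHS]/((`|a|)%:E * mu (aff a b @^-1` `]c, d]))%E.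
have [a1|a1] : a < 0 \/ 0 < a by move: a0; rewrite neq_lt => /orP.
(* A negative [a] reverses the interval, so the closed end moves to the left; the length does not
   see this. *)
- have -> : aff a b @^-1` `]c, d] = `[(d - b) / a, (c - b) / a[%classic.
    apply/seteqP; split => x /=; rewrite !in_itv/= /aff ler_ndivrMr// ltr_ndivlMr// => /andP[? ?];
    by apply/andP; split; lra.
  rewrite /= !lebesgue_measure_itv/= !lte_fin ltr_ndivlMr// divfK ?ltr0_neq0// ltrD2r.
  case: ifPn => _; rewrite ?mule0// -EFinB -EFinM ltr0_norm//; congr EFin; field.
  exact: ltr0_neq0.
- have -> : aff a b @^-1` `]c, d] = `](c - b) / a, (d - b) / a]%classic.
    apply/seteqP; split => x /=; rewrite !in_itv/= /aff ler_pdivlMr// ltr_pdivrMr// => /andP[? ?];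
    by apply/andP; split; lra.
  rewrite /= !lebesgue_measure_itv/= !lte_fin ltr_pdivrMr// divfK ?lt0r_neq0// ltrD2r.
  case: ifPn => _; rewrite ?mule0// -EFinB -EFinM gtr0_norm//; congr EFin; field.
  exact: lt0r_neq0.
Qed.

(** By the preceding lemma, [mu] is its own pushforward under the affine map, scaled by [|a|]. *)
Lemma ge0_integral_affine (a b : R) (g : R -> \bar R) : a != 0 ->
  measurable_fun setT g -> (forall x, 0 <= g x)%E ->
  (\int[mu]_x g x = `|a|%:E * \int[mu]_x g (a * x + b)%R)%E.
Proof.
move=> a0 mg g0.
have mf : measurable_fun setT (aff a b) by exact: measurable_affine.
have mg' : @measurable_fun _ _ (measurableTypeR R) _ setT g by [].
have := @ge0_integral_pushforward _ _ (measurableTypeR R) (measurableTypeR R) R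
  (aff a b) mf mu setT g measurableT mg' (fun x _ => g0 x).
rewrite preimage_setT => <-.
pose nu : {measure set _ -> \bar R} := pushforward mu (aff a b).
rewrite -[X in (X * _)%E]/((NngNum (normr_ge0 a))%:num%:E).
rewrite -(@ge0_integral_mscale _ _ R (nu mf) setT measurableT (NngNum (normr_ge0 a)) g)//.
apply: eq_measure_integral => A mA _.
by rewrite /mscale/= /pushforward/= (lebesgue_measure_affine b a0).
Qed.

End affine1.

Section linear2.
Context {R : realType}.
Local Notation mu := (@lebesgue_measure R).
Implicit Types (o a d : R * R) (G : R * R -> \bar R).

Lemma measurable_affine2 (k m n : R) (D : set (R * R)) :
  measurable_fun D (fun p : R * R => k + p.1 * m + p.2 * n).
Proof.
apply: measurable_funD; first apply: measurable_funD => //.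
- by apply: measurable_funM => //; apply: measurable_funTS; exact: measurable_fst.
- by apply: measurable_funM => //; apply: measurable_funTS; exact: measurable_snd.
Qed.

(** The affine frame with origin [o] and axes [a], [d]; its Jacobian is [a.1 * d.2 - a.2 * d.1]. *)
Definition affine_map o a d (p : R * R) : R * R :=
  (o.1 + p.1 * a.1 + p.2 * d.1, o.2 + p.1 * a.2 + p.2 * d.2).

Lemma measurable_affine_map o a d (D : set (R * R)) :
  measurable_fun D (affine_map o a d).
Proof. by apply: measurable_funTS; apply: measurable_fun_pair; exact: measurable_affine2. Qed.

Lemma ge0_integral_leb2 G : measurable_fun setT G -> (forall x, 0 <= G x)%E ->
  (\int[@leb2 R]_p G p = \int[mu]_x \int[mu]_y G (x, y))%E.
Proof. by move=> mG G0; rewrite /leb2 fubini_tonelli1. Qed.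

Lemma ge0_integral_swap G : measurable_fun setT G -> (forall x, 0 <= G x)%E ->
  (\int[mu]_x \int[mu]_y G (x, y) = \int[mu]_y \int[mu]_x G (x, y))%E.
Proof. by move=> mG G0; exact: (fubini_tonelli (m1 := mu) (m2 := mu)). Qed.

Lemma measurable_slice_integral G : measurable_fun setT G -> (forall x, 0 <= G x)%E ->
  measurable_fun setT (fun x : R => \int[mu]_y G (x, y))%E.
Proof. by move=> mG G0; apply: measurable_fun_fubini_tonelli_F. Qed.

(** Gaussian elimination with pivot [a.1]: a one-dimensional substitution in the second coordinate,
    then one in the first, with Tonelli in between. *)
Let ge0_integral_affine_map_fst o a d G : a.1 != 0 -> a.1 * d.2 - a.2 * d.1 != 0 ->
  measurable_fun setT G -> (forall x, 0 <= G x)%E ->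
  (\int[@leb2 R]_p G p = `|a.1 * d.2 - a.2 * d.1|%:E *
     \int[mu]_w \int[mu]_v G (affine_map o a d (w, v)))%E.
Proof.
move=> a0 det0 mG G0.
(* The second pivot: [c * a.1] is the determinant. *)
pose c := (a.1 * d.2 - a.2 * d.1) / a.1.
have c0 : c != 0 by rewrite mulf_neq0// invr_neq0.
(* The intermediate map: the abscissa is kept and only the ordinate is replaced by [v]. *)
pose q : R * R -> R * R :=
  affine_map (0, o.2 - a.2 / a.1 * o.1) (1, a.2 / a.1) (0, c).
have mGq : measurable_fun setT (G \o q).
  by apply: measurableT_comp => //; exact: measurable_affine_map.
have mGL : measurable_fun setT (G \o affine_map o a d).
  by apply: measurableT_comp => //; exact: measurable_affine_map.
rewrite ge0_integral_leb2//.
transitivity (\int[mu]_x (`|c|%:E * \int[mu]_v (G \o q) (x, v)))%E.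
  apply: eq_integral => x _.
  rewrite (ge0_integral_affine (o.2 - a.2 / a.1 * o.1 + x * (a.2 / a.1)) c0)//; last first.
    by apply: measurableT_comp => //.
  congr (_ * _)%E; apply: eq_integral => v _ /=; rewrite /q/=; congr (G (_, _)) => /=; ring.
rewrite ge0_integralZl; last 4 first.
- by [].
- by apply: measurable_slice_integral => // x; exact: G0.
- by move=> x _; apply: integral_ge0 => v _; exact: G0.
- by rewrite lee_fin.
rewrite (ge0_integral_swap mGq); last by move=> x; exact: G0.
transitivity (`|c|%:E * \int[mu]_v (`|a.1|%:E * \int[mu]_w (G \o affine_map o a d) (w, v)))%E.
  congr (_ * _)%E; apply: eq_integral => v _.
  rewrite (ge0_integral_affine (o.1 + v * d.1) a0); last 2 first.
  - by apply: measurableT_comp => //.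
  - by move=> x; exact: G0.
  congr (_ * _)%E; apply: eq_integral => w _ /=; rewrite /q/c/=; congr (G (_, _)) => /=; field => //.
rewrite ge0_integralZl; last 4 first.
- by [].
- apply: measurable_fun_fubini_tonelli_G => // x; exact: G0.
- by move=> x _; apply: integral_ge0 => v _; exact: G0.
- by rewrite lee_fin.
rewrite muleA -EFinM -normrM /c (divfK a0).
by rewrite -(ge0_integral_swap mGL); last by move=> x; exact: G0.
Qed.

Lemma ge0_integral_affine_map o a d G : a.1 * d.2 - a.2 * d.1 != 0 ->
  measurable_fun setT G -> (forall x, 0 <= G x)%E ->
  (\int[@leb2 R]_p G p = `|a.1 * d.2 - a.2 * d.1|%:E *
     \int[mu]_w \int[mu]_v G (affine_map o a d (w, v)))%E.
Proof.
move=> det0 mG G0.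
(* If the pivot [a.1] vanishes, [d.1] does not; exchanging the axes only changes the sign of the
   determinant. *)
have [a0|] := eqVneq a.1 0; last first.
  by move=> a0; exact: ge0_integral_affine_map_fst.
have d0 : d.1 != 0 by apply: contra_neq det0 => ->; rewrite a0; ring.
have E : d.1 * a.2 - d.2 * a.1 = - (a.1 * d.2 - a.2 * d.1) by ring.
rewrite (ge0_integral_affine_map_fst o (d := a) (G := G) d0); last 3 first.
- by rewrite E oppr_eq0.
- exact: mG.
- exact: G0.
rewrite E normrN; apply: (congr1 (fun z => _ * z)%E).
have mGL : measurable_fun setT (G \o affine_map o a d).
  by apply: measurableT_comp => //; exact: measurable_affine_map.
transitivity (\int[mu]_y \int[mu]_x (G \o affine_map o a d) (x, y))%E; last first.
  by apply/esym/(ge0_integral_swap mGL) => x; exact: G0.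
apply: eq_integral => w _; apply: eq_integral => v _ /=.
by congr (G (_, _)) => /=; ring.
Qed.

Lemma measurable_polar o a d G : measurable_fun setT G ->
  measurable_fun setT (fun p : R * R =>
    (`|p.1|%:E * G (affine_map o a d (p.1, (p.1 * p.2)%R)))%E).
Proof.
move=> mG; apply: emeasurable_funM.
  by apply/measurable_EFinP; apply: measurableT_comp => //.
apply: measurableT_comp => //.
apply: measurableT_comp; first exact: measurable_affine_map.
by apply: measurable_fun_pair => //; apply: measurable_funM.
Qed.

Lemma measurable_polar_integral o a d G : measurable_fun setT G ->
  (forall x, 0 <= G x)%E ->
  measurable_fun setT (fun t =>
    \int[mu]_w (`|w|%:E * G (affine_map o a d (w, (w * t)%R))))%E.
Proof.
move=> mG G0; apply: (@measurable_fun_fubini_tonelli_G _ _ _ _ R mu _ (measurable_polar o a d mG)).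
by move=> p; rewrite mule_ge0.
Qed.

(** For fixed [w != 0] the substitution [v = w * t] contributes the factor [|w|]. *)
Lemma ge0_integral_polar o a d G : a.1 * d.2 - a.2 * d.1 != 0 ->
  measurable_fun setT G -> (forall x, 0 <= G x)%E ->
  (\int[@leb2 R]_p G p = `|a.1 * d.2 - a.2 * d.1|%:E *
     \int[mu]_t \int[mu]_w (`|w|%:E * G (affine_map o a d (w, (w * t)%R))))%E.
Proof.
move=> det0 mG G0.
pose K (p : R * R) := (`|p.1|%:E * G (affine_map o a d (p.1, (p.1 * p.2)%R)))%E.
have K0 p : (0 <= K p)%E by rewrite mule_ge0.
have mK : measurable_fun setT K := measurable_polar o a d mG.
rewrite (ge0_integral_affine_map o det0 mG G0); apply: (congr1 (fun z => _ * z)%E).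
transitivity (\int[mu]_w \int[mu]_t K (w, t))%E; last exact: (ge0_integral_swap mK K0).
have mGL : measurable_fun setT (G \o affine_map o a d).
  by apply: measurableT_comp => //; exact: measurable_affine_map.
(* The substitution is singular at [w = 0]; this point is removed from both outer integrals as a
   null set. *)
rewrite -[LHS](@integral_setD1 _ _ 0); last 2 first.
- exact: measurableD.
- apply: measurable_funTS; apply: (measurable_slice_integral mGL) => x; exact: G0.
rewrite -[RHS](@integral_setD1 _ _ 0); last 2 first.
- exact: measurableD.
- by apply: measurable_funTS; exact: measurable_slice_integral.
apply: eq_integral => w; rewrite inE => -[_ /eqP w0].
rewrite (ge0_integral_affine 0 w0); last 2 first.
- by apply: (measurableT_comp mGL).
- by move=> x; exact: G0.
have mGw : measurable_fun setT (fun t => G (affine_map o a d (w, w * t + 0)%R)).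
  apply: (measurableT_comp mGL); apply: measurable_fun_pair => //.
  exact: measurable_affine.
rewrite -ge0_integralZl.
- by apply: eq_integral => t _; rewrite /K/= addr0.
- by [].
- exact: mGw.
- by move=> t _; exact: G0.
- by rewrite lee_fin.
Qed.

End linear2.

(** * Quadratic polynomials on the unit interval *)

Section poly01.
Context {R : realType}.
Local Notation mu := (@lebesgue_measure R).

Lemma integrable_unit_itv_continuous (g : R -> R) : continuous g ->
  mu.-integrable `[0, 1] (EFin \o g).
Proof.
move=> cg; apply: continuous_compact_integrable; first exact: segment_compact.
exact: continuous_subspaceT.
Qed.

Lemma quadratic_continuous (A B : R) : continuous (fun w : R => A * w + B * w ^+ 2).
Proof.
move=> w; apply: (@continuousD _ R^o).
  by apply: (@continuousM _ R) => //; exact: cst_continuous.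
apply: (@continuousM R R); first exact: cst_continuous.
exact: exprn_continuous.
Qed.

(** The polynomial has the form [w] times an affine function of [w], where the factor [w] is the
    polar Jacobian. *)
Lemma Rintegral_unit_itv_quadratic (A B : R) :
  \int[mu]_(w in `[0, 1]) (A * w + B * w ^+ 2) = A / 2 + B / 3.
Proof.
pose F (w : R) := A / 2 * w ^+ 2 + B / 3 * w ^+ 3.
have dF w : is_derive w (1:R) F (A * w + B * w ^+ 2).
  rewrite /F; apply: is_derive_eq.
  rewrite !scaler1 /GRing.scale/=. by field.
have cF : continuous F.
  move=> w; apply: differentiable_continuous; apply/derivable1_diffP.
  by case: (dF w).
have cf := @quadratic_continuous A B.
rewrite /Rintegral (@continuous_FTC2 _ _ F).
- by rewrite -EFinB /= /F; field.
- exact: ltr01.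
- exact: continuous_subspaceT.
- split.
  + by move=> w _; case: (dF w).
  + by apply: cvg_at_right_filter; exact: cF.
  + by apply: cvg_at_left_filter; exact: cF.
- by move=> w _; rewrite derive1E; case: (dF w).
Qed.

End poly01.

(** * Triangles in barycentric coordinates *)

Section triangle.
Context {R : realType}.
Local Notation mu := (@lebesgue_measure R).
Implicit Types (X Y Z O p q : R * R) (f : R * R -> R).

(** Twice the signed area of the triangle [O p q]. *)
Definition cross O p q : R :=
  (p.1 - O.1) * (q.2 - O.2) - (p.2 - O.2) * (q.1 - O.1).

Lemma tri_areaE X Y Z : tri_area X Y Z = `|cross X Y Z| / 2.
Proof. by []. Qed.

(** Cramer's rule for the barycentric coordinates of [p] at [Y] and [Z]; the coordinate at [X] is
    one minus their sum. *)
Definition bary2 X Y Z p : R := cross X p Z / cross X Y Z.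
Definition bary3 X Y Z p : R := cross X Y p / cross X Y Z.

Lemma triE X Y Z : cross X Y Z != 0 -> tri X Y Z =
  [set p | [/\ 0 <= bary2 X Y Z p, 0 <= bary3 X Y Z p &
               bary2 X Y Z p + bary3 X Y Z p <= 1]].
Proof.
move=> det0; apply/seteqP; split=> p.
- move=> [a [b [c [a0 b0 c0 abc ->]]]].
  have aE : a = 1 - b - c by rewrite -abc; ring.
  rewrite /mkset.
  have -> : bary2 X Y Z (a * X.1 + b * Y.1 + c * Z.1, a * X.2 + b * Y.2 + c * Z.2) = b.
    by rewrite /bary2 aE; apply: (mulIf det0); rewrite divfK// /cross/=; ring.
  have -> : bary3 X Y Z (a * X.1 + b * Y.1 + c * Z.1, a * X.2 + b * Y.2 + c * Z.2) = c.
    by rewrite /bary3 aE; apply: (mulIf det0); rewrite divfK// /cross/=; ring.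
  by split=> //; lra.
- move=> [b0 c0 bc]; exists (1 - bary2 X Y Z p - bary3 X Y Z p), (bary2 X Y Z p), (bary3 X Y Z p).
  split=> //; [lra|ring|].
  move: det0; rewrite /bary2 /bary3 /cross => det0.
  by case: p {b0 c0 bc} => p1 p2 /=; congr (_, _); field.
Qed.

(** The strict inequality removes the side [X Z], apex included, so that consecutive triangles
    around a center do not share a side. *)
Definition half_tri X Y Z : set (R * R) :=
  [set p | [/\ 0 < bary2 X Y Z p, 0 <= bary3 X Y Z p &
               bary2 X Y Z p + bary3 X Y Z p <= 1]].

Lemma bary_lerp X Y Z t w : cross X Y Z != 0 ->
  bary2 X Y Z (lerp X (lerp Y Z t) w) = w * (1 - t) /\
  bary3 X Y Z (lerp X (lerp Y Z t) w) = w * t.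
Proof.
move=> det0; rewrite /bary2 /bary3.
by split; apply: (mulIf det0); rewrite divfK// /cross/=; ring.
Qed.

(** The barycentric coordinates at [Y] and [Z] are [w * (1 - t)] and [w * t], with sum [w]. At
    [w = 0] every [t] gives the apex, which is why [w != 0] is assumed. *)
Lemma tri_lerp_iff X Y Z t w : cross X Y Z != 0 -> w != 0 ->
  tri X Y Z (lerp X (lerp Y Z t) w) <-> w \in `[0, 1] /\ t \in `[0, 1].
Proof.
move=> det0 w0; rewrite triE//=; have [-> ->] := bary_lerp t w det0.
rewrite !in_itv/=; split.
- move=> [h1 h2 h3].
  have w1 : 0 < w <= 1 by rewrite lt_neqAle eq_sym w0/=; lra.
  split; first lra.
  apply/andP; split.
  + by rewrite -(@pmulr_rge0 _ w)//; lra.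
  + by rewrite -subr_ge0 -(@pmulr_rge0 _ w)//; lra.
- move=> [/andP[? ?] /andP[? ?]]; split; [apply: mulr_ge0; lra|exact: mulr_ge0|nra].
Qed.

Lemma half_tri_lerp_iff X Y Z t w : cross X Y Z != 0 -> w != 0 ->
  half_tri X Y Z (lerp X (lerp Y Z t) w) <-> w \in `]0, 1] /\ t \in `[0, 1[.
Proof.
move=> det0 w0; rewrite /half_tri/=; have [-> ->] := bary_lerp t w det0.
rewrite !in_itv/=; split.
- move=> [h1 h2 h3].
  have w1 : 0 < w <= 1 by apply/andP; lra.
  split; first exact: w1.
  apply/andP; split.
  + by rewrite -(@pmulr_rge0 _ w)//; lra.
  + by rewrite -subr_gt0 -(@pmulr_rgt0 _ w)//; lra.
- move=> [/andP[? ?] /andP[? ?]]; split; [apply: mulr_gt0; lra|apply: mulr_ge0; lra|nra].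
Qed.

Lemma half_tri_sub X Y Z : cross X Y Z != 0 -> half_tri X Y Z `<=` tri X Y Z.
Proof. by move=> det0 p [/ltW ? ? ?]; rewrite triE. Qed.

Lemma tri_lerp X Y Z t w : 0 <= t <= 1 -> 0 <= w <= 1 ->
  tri X Y Z (lerp X (lerp Y Z t) w).
Proof.
move=> /andP[t0 t1] /andP[w0 w1].
exists (1 - w), (w * (1 - t)), (w * t); split=> /=; [lra|nra|nra|ring|].
by congr (_, _) => /=; ring.
Qed.

Lemma half_tri_decomp X Y Z p : cross X Y Z != 0 -> half_tri X Y Z p ->
  exists t w, [/\ 0 <= t < 1, 0 < w <= 1 & p = lerp X (lerp Y Z t) w].
Proof.
move=> det0 [b0 c0 bc].
(* The ratio [w] is the total weight of the edge [Y Z], and [t] is the share of [Z] in it. *)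
exists (bary3 X Y Z p / (bary2 X Y Z p + bary3 X Y Z p)), (bary2 X Y Z p + bary3 X Y Z p).
have s0 : 0 < bary2 X Y Z p + bary3 X Y Z p by lra.
split.
- by rewrite divr_ge0 ?(ltW s0)//= ltr_pdivrMr// mul1r; lra.
- by rewrite s0.
- have s1 := lt0r_neq0 s0.
  rewrite /lerp/=.
  have H (x y z b c : R) : b + c != 0 ->
      (b + c) * (y + c / (b + c) * (z - y) - x) = b * (y - x) + c * (z - x).
    by move=> ?; field.
  rewrite !H//.
  move: det0; rewrite /bary2 /bary3 /cross => det0.
  by case: p {b0 c0 bc s0 s1} => p1 p2 /=; congr (_, _); field.
Qed.

Lemma tri_rotate X Y Z : tri X Y Z = tri Y Z X.
Proof.
have H A B C : tri A B C `<=` tri B C A.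
  move=> p [a [b [c [a0 b0 c0 abc ->]]]]; exists b, c, a; split=> //; first lra.
  by congr (_, _); ring.
by apply/seteqP; split; [exact: H|move=> p /H /H].
Qed.

Lemma measurable_bary2 X Y Z D : measurable_fun D (bary2 X Y Z).
Proof.
rewrite (_ : bary2 X Y Z = fun p => (X.2 * Z.1 - X.1 * Z.2) / cross X Y Z +
  p.1 * ((Z.2 - X.2) / cross X Y Z) + p.2 * ((X.1 - Z.1) / cross X Y Z)).
  exact: measurable_affine2.
by apply/funext => p; rewrite /bary2 {1}/cross; ring.
Qed.

Lemma measurable_bary3 X Y Z D : measurable_fun D (bary3 X Y Z).
Proof.
rewrite (_ : bary3 X Y Z = fun p => (X.1 * (Y.2 - X.2) - X.2 * (Y.1 - X.1)) / cross X Y Z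
  + X.2 * 0 + p.1 * ((X.2 - Y.2) / cross X Y Z) + p.2 * ((Y.1 - X.1) / cross X Y Z)).
  exact: measurable_affine2.
by apply/funext => p; rewrite /bary3 {1}/cross; ring.
Qed.

Lemma measurable_fun_lt_set D (g h : R * R -> R) : measurable D ->
  measurable_fun D g -> measurable_fun D h -> measurable (D `&` [set p | g p < h p]).
Proof.
move=> mD mg mh.
rewrite (_ : _ `&` _ = D `\` (D `&` [set p | h p <= g p])).
  by apply: measurableD => //; exact: measurable_fun_le.
apply/seteqP; split => p /=.
- by move=> [Dp gh]; split=> // -[_]; rewrite leNgt gh.
- by move=> [Dp H]; split=> //; rewrite ltNge; apply/negP => ?; apply: H.
Qed.

Lemma measurable_tri X Y Z : cross X Y Z != 0 -> measurable (tri X Y Z).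
Proof.
move=> det0; rewrite triE//.
rewrite (_ : mkset _ = (((setT `&` [set p | 0 <= bary2 X Y Z p])
   `&` [set p | 0 <= bary3 X Y Z p]) `&`
   [set p | bary2 X Y Z p + bary3 X Y Z p <= 1])); last first.
  by apply/seteqP; split => p /= => [[? ? ?]|[[[]]]].
apply: (measurable_fun_le (f := fun p => bary2 X Y Z p + bary3 X Y Z p) (g := cst 1));
  [|by apply: measurable_funD; [exact: measurable_bary2|exact: measurable_bary3]|exact: measurable_cst].
apply: (measurable_fun_le (f := cst 0) (g := bary3 X Y Z));
  [|exact: measurable_cst|exact: measurable_bary3].
apply: (measurable_fun_le (f := cst 0) (g := bary2 X Y Z));
  [exact: measurableT|exact: measurable_cst|exact: measurable_bary2].
Qed.

Lemma measurable_half_tri X Y Z : measurable (half_tri X Y Z).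
Proof.
rewrite (_ : half_tri X Y Z = (((setT `&` [set p | 0 < bary2 X Y Z p])
   `&` [set p | 0 <= bary3 X Y Z p]) `&`
   [set p | bary2 X Y Z p + bary3 X Y Z p <= 1])); last first.
  by apply/seteqP; split => p /= => [[? ? ?]|[[[]]]].
apply: (measurable_fun_le (f := fun p => bary2 X Y Z p + bary3 X Y Z p) (g := cst 1));
  [|by apply: measurable_funD; [exact: measurable_bary2|exact: measurable_bary3]|exact: measurable_cst].
apply: (measurable_fun_le (f := cst 0) (g := bary3 X Y Z));
  [|exact: measurable_cst|exact: measurable_bary3].
apply: (measurable_fun_lt_set (g := cst 0) (h := bary2 X Y Z));
  [exact: measurableT|exact: measurable_cst|exact: measurable_bary2].
Qed.

End triangle.

(** * Convex functions on a triangle *)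

Section convex_triangle.
Context {R : realType}.
Local Notation mu := (@lebesgue_measure R).
Implicit Types (X Y Z O p q : R * R) (f : R * R -> R).

Lemma tri_vertices X Y Z : [/\ tri X Y Z X, tri X Y Z Y & tri X Y Z Z].
Proof.
split; [exists 1, 0, 0|exists 0, 1, 0|exists 0, 0, 1]; split=> //; rewrite ?addr0 ?add0r//;
  rewrite !mul1r !mul0r ?addr0 ?add0r; exact: surjective_pairing.
Qed.

Lemma tri_edge X Y Z t : 0 <= t <= 1 -> tri X Y Z (lerp Y Z t).
Proof.
move=> /andP[t0 t1]; exists 0, (1 - t), t; split=> //; [lra|lra|].
by congr (_, _) => /=; ring.
Qed.

Lemma tri_decomp X Y Z p : tri X Y Z p ->
  exists t w, [/\ 0 <= t <= 1, 0 <= w <= 1 & p = lerp X (lerp Y Z t) w].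
Proof.
move=> [a [b [c [a0 b0 c0 abc ->]]]].
have [s0|s0] := eqVneq (b + c) 0.
  have -> : b = 0 by lra. have -> : c = 0 by lra.
  (* The point is the apex, and the value of [t] is arbitrary. *)
  exists 0, 0; rewrite lexx ler01; split=> //; rewrite /lerp.
  by have -> : a = 1; [lra|congr (_, _); ring].
have s1 : 0 < b + c by rewrite lt_neqAle eq_sym s0/=; lra.
exists (c / (b + c)), (b + c); split; [|apply/andP; lra|].
  by rewrite divr_ge0 ?(ltW s1)//= ler_pdivrMr// mul1r; lra.
have -> : a = 1 - b - c by lra.
by rewrite /lerp; congr (_, _) => /=; field.
Qed.

Lemma convex_tri_lerp X Y Z f t w : convex_on (tri X Y Z) f ->
  0 <= t <= 1 -> 0 <= w <= 1 ->
  f (lerp X (lerp Y Z t) w) <= (1 - w) * f X + w * f (lerp Y Z t).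
Proof.
by move=> cf t01 w01; apply: cf => //; [case: (tri_vertices X Y Z)|exact: tri_edge].
Qed.

Lemma convex_tri_edge X Y Z f t : convex_on (tri X Y Z) f -> 0 <= t <= 1 ->
  f (lerp Y Z t) <= (1 - t) * f Y + t * f Z.
Proof. by move=> cf t01; apply: cf => //; case: (tri_vertices X Y Z). Qed.

(** Boundedness yields integrability, and later allows adding a constant to make [f] nonnegative. *)
Lemma convex_tri_bounded X Y Z f : convex_on (tri X Y Z) f ->
  exists M, forall p, tri X Y Z p -> `|f p| <= M.
Proof.
move=> cf; pose M := `|f X| + `|f Y| + `|f Z|.
have fM p : tri X Y Z p -> f p <= M.
  move=> /tri_decomp[t [w [t01 w01 ->]]].
  have := convex_tri_lerp cf t01 w01; have := convex_tri_edge cf t01.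
  have := ler_norm (f X); have := ler_norm (f Y); have := ler_norm (f Z).
  have := normr_ge0 (f X); have := normr_ge0 (f Y); have := normr_ge0 (f Z).
  rewrite /M; move/andP: t01 => [t0 t1]; move/andP: w01 => [w0 w1].
  move: `|f X| `|f Y| `|f Z| => x y z z0 y0 x0 zf yf xf h1 h2.
  have h3 : f (lerp Y Z t) <= y + z.
    apply: (le_trans h1); apply: (@le_trans _ _ ((1 - t) * y + t * z)); last by nra.
    by apply: lerD; apply: ler_wpM2l => //; lra.
  apply: (le_trans h2); apply: (@le_trans _ _ ((1 - w) * x + w * (y + z))); last by nra.
  by apply: lerD; apply: ler_wpM2l => //; lra.
(* reflecting through the centroid [g] turns the upper bound into a lower bound *)
pose g : R * R := ((X.1 + Y.1 + Z.1) / 3, (X.2 + Y.2 + Z.2) / 3).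
exists (`|3 * f g| + 2 * M) => p Tp.
have M0 : 0 <= M by rewrite /M !addr_ge0.
rewrite ler_norml; apply/andP; split; last first.
  by apply: (le_trans (fM _ Tp)); have := normr_ge0 (3 * f g); lra.
case: (Tp) => a [b [c [a0 b0 c0 abc pE]]].
(* The centroid is [p / 3 + 2 q / 3]; as [3 g] has all coordinates 1, those of [q] are [(1 - a) / 2]
   and so on, hence nonnegative. *)
pose q : R * R := ((3 * g.1 - p.1) / 2, (3 * g.2 - p.2) / 2).
have Tq : tri X Y Z q.
  exists ((1 - a) / 2), ((1 - b) / 2), ((1 - c) / 2); split; [lra|lra|lra|lra|].
  by rewrite /q/g pE; congr (_, _) => /=; field.
have gE : g = lerp p q (2 / 3).
  by rewrite /lerp /q [LHS]surjective_pairing; congr (_, _) => /=; field.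
have t01 : 0 <= (2 / 3 : R) <= 1 by apply/andP; lra.
have := cf _ _ Tp Tq _ t01; rewrite -gE => h.
have := ler_norm (- (3 * f g)); rewrite normrN; have := fM _ Tq; move: h => h1 h2 h3; lra.
Qed.

Lemma bary_affine X Y Z p q t :
  bary2 X Y Z (lerp p q t) = (1 - t) * bary2 X Y Z p + t * bary2 X Y Z q /\
  bary3 X Y Z (lerp p q t) = (1 - t) * bary3 X Y Z p + t * bary3 X Y Z q.
Proof. by rewrite /bary2 /bary3 /cross /lerp/=; split; ring. Qed.

(* Upper semicontinuity up to the boundary: [q] is the convex combination of
   [p], with weight [1 - e], and of a point of the triangle. *)
Lemma convex_tri_usc X Y Z f M p q e : cross X Y Z != 0 ->
  convex_on (tri X Y Z) f -> (forall r, tri X Y Z r -> f r <= M) ->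
  tri X Y Z p -> 0 < e <= 1 ->
  (1 - e) * (1 - bary2 X Y Z p - bary3 X Y Z p) <= 1 - bary2 X Y Z q - bary3 X Y Z q ->
  (1 - e) * bary2 X Y Z p <= bary2 X Y Z q ->
  (1 - e) * bary3 X Y Z p <= bary3 X Y Z q ->
  f q <= (1 - e) * f p + e * M.
Proof.
move=> det0 cf fM Tp /andP[e0 e1] h1 h2 h3.
(* [z] solves [q = (1 - e) p + e z]; the three inequalities assumed say that its barycentric
   coordinates are nonnegative. *)
pose z := lerp p q e^-1.
have e00 := lt0r_neq0 e0.
have Tz : tri X Y Z z.
  rewrite triE//= /z; have [-> ->] := bary_affine X Y Z p q e^-1.
  have H (x y : R) : (1 - e^-1) * x + e^-1 * y = e^-1 * (y - (1 - e) * x) by field.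
  rewrite !H; have i0 : 0 < e^-1 by rewrite invr_gt0.
  split; [apply: mulr_ge0; lra|apply: mulr_ge0; lra|].
  rewrite -mulrDr mulrC ler_pdivrMr// mul1r; lra.
have qE : q = lerp p z e.
  by rewrite /z /lerp [LHS]surjective_pairing; congr (_, _) => /=; field.
have e01 : 0 <= e <= 1 by rewrite (ltW e0).
have := cf _ _ Tp Tz _ e01; rewrite -qE => /le_trans; apply.
by rewrite lerD2l ler_wpM2l ?(ltW e0)// fM.
Qed.

(** At [x = 0] the interval shrinks to a point and [r = 0] serves; this covers the points on the
    sides of the triangle. *)
Lemma rat_between0 (x e : R) : 0 <= x -> 0 < e -> exists r : rat, (1 - e) * x <= ratr r <= x.
Proof.
rewrite le_eqVlt => /predU1P[<-|x0] e0.
  by exists 0; rewrite mulr0 rmorph0 lexx.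
have : (1 - e) * x < x by nra.
by move=> /rat_in_itvoo[r]; rewrite in_itv/= => /andP[/ltW ? /ltW ?]; exists r; apply/andP.
Qed.

(* Sublevel sets are countable unions of the sets cut out by rational lower
   bounds on the three barycentric coordinates. *)
Lemma convex_tri_measurable X Y Z f : cross X Y Z != 0 ->
  convex_on (tri X Y Z) f -> measurable_fun (tri X Y Z) f.
Proof.
move=> det0 cf; have mT := measurable_tri det0.
have [M fM] := convex_tri_bounded cf.
apply: (measurability _ (RGenInftyO.measurableE R)) => _ [_ [y ->] <-].
pose B (r1 r2 r3 : rat) : set (R * R) := ((tri X Y Z `&`
  [set p | ratr r1 <= 1 - bary2 X Y Z p - bary3 X Y Z p]) `&`
  [set p | ratr r2 <= bary2 X Y Z p]) `&` [set p | ratr r3 <= bary3 X Y Z p].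
have mB r1 r2 r3 : measurable (B r1 r2 r3).
  apply: (measurable_fun_le (f := cst (ratr r3)) (g := bary3 X Y Z));
    [|exact: measurable_cst|exact: measurable_bary3].
  apply: (measurable_fun_le (f := cst (ratr r2)) (g := bary2 X Y Z));
    [|exact: measurable_cst|exact: measurable_bary2].
  apply: (measurable_fun_le (f := cst (ratr r1)) (g := fun p => 1 - bary2 X Y Z p - bary3 X Y Z p));
    [exact: mT|exact: measurable_cst|].
  apply: measurable_funB; last exact: measurable_bary3.
  by apply: measurable_funB => //; exact: measurable_bary2.
(* Only the pieces on which [f < y] throughout are kept. *)
pose C r1 r2 r3 : set (R * R) := if `[< B r1 r2 r3 `<=` [set p | f p < y] >] then B r1 r2 r3 else set0.
have mC r1 r2 r3 : measurable (C r1 r2 r3) by rewrite /C; case: ifP.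
rewrite (_ : _ `&` _ = \bigcup_r1 \bigcup_r2 \bigcup_r3 C r1 r2 r3).
  by do 3 (apply: bigcupT_measurable_rat => ?).
apply/seteqP; split => p; last first.
  move=> [r1 _ [r2 _ [r3 _]]]; rewrite /C; case: ifPn => // /asboolP BS Bp.
  by split; [case: Bp => -[[]]|have /= := BS _ Bp; rewrite in_itv].
move=> [Tp]; rewrite /= in_itv/= => fpy.
have fM' r : tri X Y Z r -> f r <= M by move=> /fM; apply: le_trans; exact: ler_norm.
(* Chosen so that [e * (M - f p) < y - f p]; the summand 1 makes the inequality strict. *)
pose e := (y - f p) / (y - f p + (M - f p) + 1).
have Mp := fM' _ Tp.
have den0 : 0 < y - f p + (M - f p) + 1 by lra.
have e0 : 0 < e by rewrite divr_gt0// subr_gt0.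
have e1 : e <= 1 by rewrite ler_pdivrMr// mul1r; lra.
have He : (1 - e) * f p + e * M < y.
  have : e * (y - f p + (M - f p) + 1) = y - f p by rewrite divfK// lt0r_neq0.
  by nra.
move: (Tp); rewrite triE//= => -[b2 b3 b1].
have b1' : 0 <= 1 - bary2 X Y Z p - bary3 X Y Z p by lra.
have [r1 /andP[r1l r1u]] := rat_between0 b1' e0.
have [r2 /andP[r2l r2u]] := rat_between0 b2 e0.
have [r3 /andP[r3l r3u]] := rat_between0 b3 e0.
exists r1 => //; exists r2 => //; exists r3 => //; rewrite /C.
case: ifPn => [_|/asboolP]; first by [].
move=> H; exfalso; apply: H => q [[[Tq q1] q2] q3] /=.
apply: le_lt_trans He.
apply: (convex_tri_usc det0 cf fM' Tp) => //; first by rewrite e0.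
- exact: le_trans q1.
- exact: le_trans q2.
- exact: le_trans q3.
Qed.

End convex_triangle.

(** * Averages over a triangle *)

Section cone.
Context {R : realType}.
Local Notation mu := (@lebesgue_measure R).
Implicit Types (X Y Z O p q : R * R) (f : R * R -> R).

(** The slope [m] is the supremum of the left slopes at [c]. Every right slope bounds them, because
    [c] is a convex combination of a point on each side. *)
Lemma convex_support (phi : R -> R) (c : R) : 0 < c < 1 ->
  (forall x y t, 0 <= x <= 1 -> 0 <= y <= 1 -> 0 <= t <= 1 ->
    phi (x + t * (y - x)) <= (1 - t) * phi x + t * phi y) ->
  exists m, forall w, 0 <= w <= 1 -> phi c + m * (w - c) <= phi w.
Proof.
move=> /andP[c0 c1] cvx.
have slope s u : 0 <= s < c -> c < u <= 1 ->
    (phi c - phi s) / (c - s) <= (phi u - phi c) / (u - c).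
  move=> /andP[s0 sc] /andP[cu u1].
  have us : 0 < u - s by lra.
  have t01 : 0 <= (c - s) / (u - s) <= 1.
    by rewrite divr_ge0 ?(ltW us)//= ?ler_pdivrMr//; lra.
  have s01 : 0 <= s <= 1 by apply/andP; lra.
  have u01 : 0 <= u <= 1 by apply/andP; lra.
  have := cvx s u _ s01 u01 t01; rewrite divfK ?lt0r_neq0// (_ : s + (c - s) = c); last by ring.
  move=> h.
  have {}h : phi c * (u - s) <= (u - c) * phi s + (c - s) * phi u.
    rewrite -ler_pdivlMr//; apply: (le_trans h); rewrite le_eqVlt; apply/orP; left; apply/eqP.
    by field; exact: lt0r_neq0.
  rewrite ler_pdivrMr ?subr_gt0// mulrAC ler_pdivlMr ?subr_gt0//; nra.
pose S := [set (phi c - phi s) / (c - s) | s in [set s | 0 <= s < c]].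
have S0 : S !=set0 by exists ((phi c - phi 0) / (c - 0)), 0 => //=; rewrite lexx.
have Sub u : c < u <= 1 -> ubound S ((phi u - phi c) / (u - c)).
  by move=> cu _ [s /= sc <-]; exact: slope.
exists (sup S) => w /andP[w0 w1].
have [wc|cw|->] := ltgtP w c; last by rewrite subrr mulr0 addr0.
- have : (phi c - phi w) / (c - w) <= sup S.
    apply: ub_le_sup; last by exists w => //=; rewrite w0.
    by exists ((phi 1 - phi c) / (1 - c)); apply: Sub; rewrite c1 lexx.
  by rewrite ler_pdivrMr ?subr_gt0//; nra.
- have cw1 : c < w <= 1 by rewrite cw.
  have := ge_sup S0 (Sub _ cw1).
  by rewrite ler_pdivlMr ?subr_gt0//; lra.
Qed.

Lemma measurable_lerp P Q : measurable_fun setT (@lerp R P Q).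
Proof.
rewrite (_ : lerp P Q = fun t => ((Q.1 - P.1) * t + P.1, (Q.2 - P.2) * t + P.2)).
  by apply: measurable_fun_pair; exact: measurable_affine.
by apply/funext => t; rewrite /lerp; congr (_, _); ring.
Qed.

(** The polar formula with apex [X], stated for any region that is a product [W] by [T] in the
    coordinates [(w, t)]: it serves closed and half-open triangles alike. *)
Lemma measurable_cone X Y Z D (W T : set R) f : cross X Y Z != 0 ->
  measurable D -> measurable W -> measurable T -> measurable_fun D f ->
  (forall p, D p -> 0 <= f p) -> (forall w, W w -> 0 <= w) ->
  (forall t w, w != 0 -> D (lerp X (lerp Y Z t) w) <-> W w /\ T t) ->
  measurable_fun T (fun t => \int[mu]_(w in W) (w * f (lerp X (lerp Y Z t) w))%:E)%E /\
  (\int[@leb2 R]_(p in D) (f p)%:E = `|cross X Y Z|%:E *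
    \int[mu]_(t in T) \int[mu]_(w in W) (w * f (lerp X (lerp Y Z t) w))%:E)%E.
Proof.
move=> det0 mD mW mT mf f0 W0 DE.
pose G : R * R -> \bar R := (EFin \o f) \_ D.
have mG : measurable_fun setT G.
  apply/(measurable_restrictT _ mD).
  exact/measurable_EFinP.
have G0 p : (0 <= G p)%E.
  by rewrite /G patchE; case: ifPn => //; rewrite inE => /f0; rewrite lee_fin.
(* With these axes, the point with coordinates [(w, w * t)] is [X + w (Q_t - X)], [Q_t] on the edge
   [Y Z]. *)
pose a : R * R := (Y.1 - X.1, Y.2 - X.2); pose d : R * R := (Z.1 - Y.1, Z.2 - Y.2).
have detE : a.1 * d.2 - a.2 * d.1 = cross X Y Z by rewrite /cross/=; ring.
have affE w t : affine_map X a d (w, w * t) = lerp X (lerp Y Z t) w.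
  by rewrite /affine_map /lerp/=; congr (_, _); ring.
pose H t : \bar R := (\int[mu]_(w in W) (w * f (lerp X (lerp Y Z t) w))%:E)%E.
have HE t : (\int[mu]_w (`|w|%:E * G (affine_map X a d (w, (w * t)%R))))%E = (H \_ T) t.
  rewrite /H patchE.
  transitivity (\int[mu]_w
     (((fun w => if t \in T then (w * f (lerp X (lerp Y Z t) w))%:E else 0%E) \_ W) w))%E.
    apply: eq_integral => w _; rewrite affE /G !patchE.
    (* At [w = 0] the Jacobian kills both integrands, so it does not matter whether the apex belongs
       to [D]. *)
    have [->|w0] := eqVneq w 0.
      by rewrite normr0 mul0e mul0r; do ! case: ifP.
    have [/set_mem Dp|nDp] := boolP (_ \in D).
      have [Ww Tt] := (DE t w w0).1 Dp.
      by rewrite (mem_set Ww) (mem_set Tt) /= -EFinM ger0_norm// W0.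
    rewrite mule0; case: ifPn => // Ww; case: ifPn => // Tt.
    by move/negP: nDp; case; apply/mem_set/DE => //; rewrite inE in Ww; rewrite inE in Tt.
  rewrite -integral_mkcond; case: ifPn => // _.
  by rewrite integral0.
split.
  apply/(measurable_restrictT _ mT); rewrite (_ : _ \_ _ = fun t =>
     \int[mu]_w (`|w|%:E * G (affine_map X a d (w, (w * t)%R))))%E.
    exact: measurable_polar_integral.
  by apply/funext => t; rewrite HE.
rewrite integral_mkcond -/G -detE (ge0_integral_polar X (a := a) (d := d) _ mG G0) ?detE//.
apply: (congr1 (fun z => _ * z)%E).
rewrite [RHS]integral_mkcond; apply: eq_integral => t _.
exact: HE.
Qed.

End cone.

Section tri_inequalities.
Context {R : realType}.
Local Notation mu := (@lebesgue_measure R).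
Implicit Types (X Y Z O p q : R * R) (f : R * R -> R).

HB.instance Definition _ := Measure.on (@leb2 R).

Lemma integrable_unit_itv_bounded (g : R -> R) (M : R) :
  measurable_fun (`[0%R, 1%R]%classic : set R) g -> (forall t, 0 <= t <= 1 -> `|g t| <= M) ->
  mu.-integrable `[0%R, 1%R] (EFin \o g).
Proof.
move=> mg gM; apply: (@measurable_bounded_integrable _ (measurableTypeR R) R mu).
- exact: measurable_itv.
- by rewrite /= lebesgue_measure_itv/= lte_fin ltr01 -EFinB ltry.
- exact: mg.
- exists M; split; first exact: num_real.
  move=> x Mx t /=; rewrite in_itv/= => t01.
  by apply: le_trans (ltW Mx); exact: gM.
Qed.

Lemma measurable_convex_lerp X Y Z f P Q : cross X Y Z != 0 ->
  convex_on (tri X Y Z) f -> (forall t, 0 <= t <= 1 -> tri X Y Z (lerp P Q t)) ->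
  measurable_fun (`[0%R, 1%R]%classic : set R) (fun t => f (lerp P Q t)).
Proof.
move=> det0 cf PQ.
apply: (measurable_comp (measurable_tri det0) _ (convex_tri_measurable det0 cf)).
  by move=> q [t /=]; rewrite in_itv/= => t01 <-; exact: PQ.
by apply: measurable_funTS; exact: measurable_lerp.
Qed.

Lemma integrable_convex_lerp X Y Z f P Q : cross X Y Z != 0 ->
  convex_on (tri X Y Z) f -> (forall t, 0 <= t <= 1 -> tri X Y Z (lerp P Q t)) ->
  mu.-integrable `[0%R, 1%R] (EFin \o (fun t => f (lerp P Q t))).
Proof.
move=> det0 cf PQ; have [M fM] := convex_tri_bounded cf.
apply: (@integrable_unit_itv_bounded _ M); first exact: (measurable_convex_lerp det0).
by move=> t t01; apply: fM; exact: PQ.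
Qed.

Lemma integrable_weighted_convex_lerp X Y Z f P Q : cross X Y Z != 0 ->
  convex_on (tri X Y Z) f -> (forall t, 0 <= t <= 1 -> tri X Y Z (lerp P Q t)) ->
  mu.-integrable `[0%R, 1%R] (EFin \o (fun t => t * f (lerp P Q t))).
Proof.
move=> det0 cf PQ; have [M fM] := convex_tri_bounded cf.
apply: (@integrable_unit_itv_bounded _ M).
  by apply: measurable_funM => //; exact: (measurable_convex_lerp det0).
move=> t /andP[t0 t1]; rewrite normrM ger0_norm//.
apply: le_trans (fM _ (PQ t _)); last by rewrite t0.
by rewrite ler_piMl.
Qed.

(** The inner integral of the polar formula; the weight [w] has total mass [1 / 2]. *)
Definition radial_integral f X Q : R :=
  \int[mu]_(w in `[0%R, 1%R]) (w * f (lerp X Q w)).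

Lemma radial_integral_le X Y Z f t : cross X Y Z != 0 ->
  convex_on (tri X Y Z) f -> 0 <= t <= 1 ->
  radial_integral f X (lerp Y Z t) <= f X / 6 + f (lerp Y Z t) / 3.
Proof.
move=> det0 cf t01; set Q := lerp Y Z t.
(* The convexity bound [w ((1 - w) f X + w f Q)] has coefficients [f X] and [f Q - f X]. *)
have -> : f X / 6 + f Q / 3 = f X / 2 + (f Q - f X) / 3 by field.
rewrite -Rintegral_unit_itv_quadratic; apply: le_Rintegral.
- exact: measurable_itv.
- apply: (integrable_weighted_convex_lerp det0 cf) => w w01; exact: tri_lerp.
- apply: integrable_unit_itv_continuous; exact: quadratic_continuous.
- move=> w /=; rewrite in_itv/= => w01.
  have := convex_tri_lerp cf t01 w01; rewrite -/Q => h.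
  by move/andP: w01 => [w0 w1]; nra.
Qed.

(* Jensen's inequality for the probability density [2 w] on the unit interval,
   whose mean is [2 / 3] *)
Lemma radial_integral_ge X Y Z f t : cross X Y Z != 0 ->
  convex_on (tri X Y Z) f -> 0 <= t <= 1 ->
  f (lerp X (lerp Y Z t) (2 / 3)) / 2 <= radial_integral f X (lerp Y Z t).
Proof.
move=> det0 cf t01; set Q := lerp Y Z t.
have c01 : 0 < (2 / 3 : R) < 1 by apply/andP; lra.
have [|m hm] := @convex_support R (fun w => f (lerp X Q w)) _ c01.
  move=> x y s x01 y01 s01.
  have := cf _ _ (tri_lerp X Y Z t01 x01) (tri_lerp X Y Z t01 y01) s s01.
  rewrite -/Q (_ : lerp (lerp X Q x) (lerp X Q y) s = lerp X Q (x + s * (y - x)))//.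
  by rewrite /lerp/=; congr (_, _); ring.
set c : R := 2 / 3 in hm *.
(* The weighted supporting line has coefficients [f (lerp X Q c) - m * c] and [m]; the terms in [m]
   cancel since [c = 2 / 3]. *)
have -> : f (lerp X Q c) / 2 = (f (lerp X Q c) - m * c) / 2 + m / 3.
  by rewrite /c; field.
rewrite -Rintegral_unit_itv_quadratic; apply: le_Rintegral.
- exact: measurable_itv.
- apply: integrable_unit_itv_continuous; exact: quadratic_continuous.
- apply: (integrable_weighted_convex_lerp det0 cf) => w w01; exact: tri_lerp.
- move=> w /=; rewrite in_itv/= => w01.
  have := hm w w01; move/andP: w01 => [w0 w1] h.
  have := ler_wpM2l w0 h; lra.
Qed.

(** The polar formula for the constant 1. Both triangles give the same value, since the coordinate
    intervals differ only in endpoints. *)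
Lemma leb2_tri_half X Y Z : cross X Y Z != 0 ->
  leb2 (tri X Y Z) = (tri_area X Y Z)%:E /\ leb2 (half_tri X Y Z) = (tri_area X Y Z)%:E.
Proof.
move=> det0.
have I1 : (\int[mu]_(w in `[0%R, 1%R]) (w * 1)%:E = (1 / 2)%:E)%E.
  have := @Rintegral_unit_itv_quadratic R 1 0.
  rewrite mul0r addr0 => <-; rewrite /Rintegral fineK.
    by apply: eq_integral => w _; rewrite mul0r addr0 mulrC.
  apply: integrable_fin_num; first exact: measurable_itv.
  apply: integrable_unit_itv_continuous; exact: quadratic_continuous.
have I2 : (\int[mu]_(w in `]0%R, 1%R]) (w * 1)%:E = (1 / 2)%:E)%E.
  rewrite integral_itv_obnd_cbnd//.
  by apply/measurable_EFinP; exact: measurable_funM.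
have H D (W T : set R) : measurable D -> measurable W -> measurable T ->
    (forall w, W w -> 0 <= w) ->
    (forall t w, w != 0 -> D (lerp X (lerp Y Z t) w) <-> W w /\ T t) ->
    (\int[mu]_(w in W) (w * 1)%:E = (1 / 2)%:E)%E -> mu T = 1%E ->
    leb2 D = (tri_area X Y Z)%:E.
  move=> mD mW mT W0 DE IW T1.
  have [|_ ] := @measurable_cone R X Y Z D W T (fun=> 1) det0 mD mW mT _ (fun _ _ => ler01) W0 DE.
    exact: measurable_cst.
  rewrite integral_cst// mul1e => ->.
  rewrite (eq_integral (cst (1 / 2)%:E)); last by move=> t _; exact: IW.
  rewrite integral_cst; last exact: mT.
  by rewrite /= T1 mule1 -EFinM tri_areaE mul1r.
split.
- apply: (H _ `[0%R, 1%R]%classic `[0%R, 1%R]%classic) => //.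
  + exact: measurable_tri.
  + by move=> w /=; rewrite in_itv/= => /andP[].
  + by move=> t w w0; exact: tri_lerp_iff.
  + by rewrite /= lebesgue_measure_itv/= lte_fin ltr01 -EFinB subr0.
- apply: (H _ `]0%R, 1%R]%classic `[0%R, 1%R[%classic) => //.
  + exact: measurable_half_tri.
  + by move=> w /=; rewrite in_itv/= => /andP[/ltW].
  + by move=> t w w0; exact: half_tri_lerp_iff.
  + by rewrite /= lebesgue_measure_itv/= lte_fin ltr01 -EFinB subr0.
Qed.

Lemma integrable_convex_tri X Y Z f : cross X Y Z != 0 ->
  convex_on (tri X Y Z) f -> (@leb2 R).-integrable (tri X Y Z) (EFin \o f).
Proof.
move=> det0 cf; have [M fM] := convex_tri_bounded cf.
apply: measurable_bounded_integrable.
- exact: measurable_tri.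
- by have [aT _] := leb2_tri_half det0; rewrite /= aT ltry.
- exact: convex_tri_measurable.
- exists M; split; first exact: num_real.
  by move=> x Mx t Tt; apply: le_trans (ltW Mx); exact: fM.
Qed.

(** The two regions have equal finite area, so their difference is a null set. *)
Lemma Rintegral_half_tri X Y Z f : cross X Y Z != 0 -> convex_on (tri X Y Z) f ->
  Rintegral (@leb2 R) (half_tri X Y Z) f = Rintegral (@leb2 R) (tri X Y Z) f.
Proof.
move=> det0 cf.
have mT := measurable_tri det0; have mH := measurable_half_tri X Y Z.
have [aT aH] := leb2_tri_half det0.
have HT := half_tri_sub det0.
have fT := integrable_convex_tri det0 cf.
pose N := tri X Y Z `\` half_tri X Y Z.
have mN : measurable N by exact: measurableD.
have N0 : leb2 N = 0%E.
  rewrite /N [LHS]measureD//; last by rewrite /= aT ltry.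
  by rewrite /= setIidr// aT aH -EFinB subrr.
rewrite /Rintegral; congr fine.
rewrite [RHS](negligible_integral _ _ fT N0); [|exact: mN|exact: mT].
by rewrite /N setDD setIidr.
Qed.

(** The radial bounds are integrated over the edge; nonnegativity of [f] gives access to the Tonelli
    form of the polar formula. *)
Let ge0_tri_bounds X Y Z f : cross X Y Z != 0 -> convex_on (tri X Y Z) f ->
  (forall p, tri X Y Z p -> 0 <= f p) ->
  tri_area X Y Z * avg_seg f (homothety X (2 / 3) Y) (homothety X (2 / 3) Z)
    <= Rintegral (@leb2 R) (tri X Y Z) f
    <= tri_area X Y Z * (f X / 3 + 2 / 3 * avg_seg f Y Z).
Proof.
move=> det0 cf f0.
have mf := convex_tri_measurable det0 cf.
have W0 (w : R) : `[0%R, 1%R]%classic w -> 0 <= w by rewrite /= in_itv/= => /andP[].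
have [mJ] := measurable_cone det0 (measurable_tri det0) (measurable_itv _)
  (measurable_itv _) mf f0 W0 (fun t w w0 => tri_lerp_iff t det0 w0).
pose J t := radial_integral f X (lerp Y Z t).
have JE t : t \in `[0%R, 1%R]%classic ->
    (\int[mu]_(w in `[0%R, 1%R]) (w * f (lerp X (lerp Y Z t) w))%:E)%E = (J t)%:E.
  rewrite inE/= in_itv/= => t01; rewrite /J /radial_integral /Rintegral fineK//.
  apply: integrable_fin_num; first exact: measurable_itv.
  apply: (integrable_weighted_convex_lerp det0 cf) => w w01; exact: tri_lerp.
rewrite (@eq_integral _ (measurableTypeR R) R mu _ (EFin \o J)); last by move=> t t01; exact: JE.
have {}mJ : measurable_fun (`[0%R, 1%R]%classic : set R) (EFin \o J).
  by apply: eq_measurable_fun mJ => t t01; exact: JE.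
have J0 t : `[0%R, 1%R]%classic t -> (0 <= (EFin \o J) t)%E.
  rewrite /= in_itv/= => t01; rewrite lee_fin; apply: Rintegral_ge0 => w.
  by rewrite /= in_itv/= => /andP[w0 w1]; rewrite mulr_ge0// f0//; apply: tri_lerp => //; rewrite w0.
move=> IE.
have iYZ := integrable_convex_lerp det0 cf (fun t t01 => tri_edge X Y Z t01).
pose Y' := homothety X (2 / 3) Y; pose Z' := homothety X (2 / 3) Z.
(* The shrunk edge is the locus [w = 2 / 3], traversed with the same parameter [t]. *)
have lerpE t : lerp Y' Z' t = lerp X (lerp Y Z t) (2 / 3).
  by rewrite /lerp/=; congr (_, _); ring.
have c01 : 0 <= (2 / 3 : R) <= 1 by apply/andP; lra.
have YZ' t : 0 <= t <= 1 -> tri X Y Z (lerp Y' Z' t).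
  by move=> t01; rewrite lerpE; exact: tri_lerp.
have iYZ' := integrable_convex_lerp det0 cf YZ'.
have m01 : measurable (`[0%R, 1%R]%classic : set (measurableTypeR R)) by exact: measurable_itv.
have lb : ((avg_seg f Y' Z' / 2)%:E <= \int[mu]_(t in `[0%R, 1%R]) (EFin \o J) t)%E.
  have -> : (avg_seg f Y' Z' / 2)%:E = (\int[mu]_(t in `[0%R, 1%R]) (f (lerp Y' Z' t) / 2)%:E)%E.
    rewrite /avg_seg -RintegralZr// /Rintegral fineK//.
    exact: (integrable_fin_num m01 (integrableZr m01 2^-1 iYZ')).
  apply: ge0_le_integral => //.
  - move=> t /=; rewrite in_itv/= => t01.
    by rewrite lee_fin divr_ge0// f0//; exact: YZ'.
  - apply/measurable_EFinP; apply: measurable_funM => //.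
    exact: (measurable_convex_lerp det0).
  - move=> t /=; rewrite in_itv/= => t01; rewrite lee_fin lerpE.
    exact: radial_integral_ge.
have ub : (\int[mu]_(t in `[0%R, 1%R]) (EFin \o J) t <= (f X / 6 + avg_seg f Y Z / 3)%:E)%E.
  have iX : mu.-integrable `[0%R, 1%R] (EFin \o (fun=> f X / 6)).
    by apply: integrable_unit_itv_continuous; exact: cst_continuous.
  have iA : mu.-integrable `[0%R, 1%R] (EFin \o (fun t => f (lerp Y Z t) / 3)).
    exact: (integrableZr m01 3^-1 iYZ).
  have iD : mu.-integrable `[0%R, 1%R]
      (EFin \o (fun t => f X / 6 + f (lerp Y Z t) / 3)).
    exact: (integrableD m01 iX iA).
  have -> : f X / 6 + avg_seg f Y Z / 3 =
      \int[mu]_(t in `[0%R, 1%R]) (f X / 6 + f (lerp Y Z t) / 3).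
    rewrite RintegralD// (RintegralZr 3^-1 m01 iYZ); congr (_ + _).
    by rewrite Rintegral_cst//= lebesgue_measure_itv/= lte_fin ltr01 -EFinB/= subr0 mulr1.
  rewrite /Rintegral fineK; last exact: (integrable_fin_num m01 iD).
  apply: ge0_le_integral => //.
  - apply/measurable_EFinP; apply: measurable_funD => //.
    apply: measurable_funM => //.
    by apply: (measurable_convex_lerp det0 cf) => t t01; exact: tri_edge.
  - move=> t /=; rewrite in_itv/= => t01; rewrite lee_fin.
    exact: radial_integral_le.
(* Finiteness, obtained from the upper bound, allows the return from extended to real numbers. *)
have : ((\int[mu]_(t in `[0%R, 1%R]) (EFin \o J) t)%E \is a fin_num).
  by rewrite ge0_fin_numE; [apply: (le_lt_trans ub); rewrite ltry|exact: integral_ge0].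
move: IE; rewrite /Rintegral => ->.
case: (\int[mu]_(t in `[0%R, 1%R]) _)%E lb ub => // r; rewrite !lee_fin => lb ub _.
rewrite /= tri_areaE -!mulrA; apply/andP; split; apply: ler_wpM2l => //; lra.
Qed.

Lemma avg_segD f P Q c : mu.-integrable `[0%R, 1%R] (EFin \o (fun t => f (lerp P Q t))) ->
  avg_seg (fun p => f p + c) P Q = avg_seg f P Q + c.
Proof.
move=> iPQ; rewrite /avg_seg RintegralD//.
- rewrite Rintegral_cst//= lebesgue_measure_itv/= lte_fin ltr01 -EFinB/= subr0 mulr1//.
- by apply: integrable_unit_itv_continuous; exact: cst_continuous.
Qed.

(** Adding the constant [M] makes [f] nonnegative and shifts all three members by [M] times the
    area, as [1 / 3 + 2 / 3 = 1]. *)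
Lemma tri_bounds X Y Z f : cross X Y Z != 0 -> convex_on (tri X Y Z) f ->
  tri_area X Y Z * avg_seg f (homothety X (2 / 3) Y) (homothety X (2 / 3) Z)
    <= Rintegral (@leb2 R) (tri X Y Z) f
    <= tri_area X Y Z * (f X / 3 + 2 / 3 * avg_seg f Y Z).
Proof.
move=> det0 cf; have [M fM] := convex_tri_bounded cf.
pose g p := f p + M.
have cg : convex_on (tri X Y Z) g.
  by move=> x y Tx Ty t t01; have := cf x y Tx Ty t t01; rewrite /g; lra.
have g0 p : tri X Y Z p -> 0 <= g p.
  by move=> /fM; rewrite ler_norml /g => /andP[]; lra.
have mT := measurable_tri det0.
have [aT _] := leb2_tri_half det0.
have fT := integrable_convex_tri det0 cf.
have := ge0_tri_bounds det0 cg g0.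
have -> : Rintegral (@leb2 R) (tri X Y Z) g = Rintegral (@leb2 R) (tri X Y Z) f + M * tri_area X Y Z.
  rewrite /g RintegralD//; first by rewrite Rintegral_cst//= aT.
  apply: measurable_bounded_integrable => //; first by rewrite /= aT ltry.
  exists `|M|; split; first exact: num_real.
  by move=> x Mx t _; exact: ltW.
rewrite !avg_segD.
- rewrite /g => /andP[h1 h2]; apply/andP; split; lra.
- by apply: (integrable_convex_lerp det0 cf) => t t01; exact: tri_edge.
- apply: (integrable_convex_lerp det0 cf) => t t01.
  rewrite (_ : lerp _ _ t = lerp X (lerp Y Z t) (2 / 3)).
    by apply: tri_lerp => //; apply/andP; lra.
  by rewrite /lerp/=; congr (_, _); ring.
Qed.

End tri_inequalities.

(** * Geometry of nice polygons *)

Section geometry.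
Context {R : realType}.
Implicit Types (X Y Z O p q : R * R) (P : set (R * R)).

Lemma lerp_continuous O p : continuous (lerp O p).
Proof.
have H (a b : R) : continuous (fun t : R => a + t * b).
  by move=> t; apply: cvgD; [exact: cvg_cst|apply: cvgM; [exact: cvg_id|exact: cvg_cst]].
move=> t; apply: (@cvg_pair _ _ _ _ (nbhs (lerp O p t).1) (nbhs (lerp O p t).2)).
- exact: H.
- exact: H.
Qed.

Lemma lerp_endpoint_continuous O (l : R) : continuous (fun p => lerp O p l).
Proof.
have H (a b : R) (g : R * R -> R) : continuous g -> continuous (fun p => a + l * (g p - b)).
  move=> cg p; apply: cvgD; first exact: cvg_cst.
  by apply: cvgM; [exact: cvg_cst|apply: cvgB; [exact: cg|exact: cvg_cst]].
move=> p; apply: (@cvg_pair _ _ _ _ (nbhs (lerp O p l).1) (nbhs (lerp O p l).2)).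
- by apply: H => q; exact: cvg_fst.
- by apply: H => q; exact: cvg_snd.
Qed.

Lemma lerp_lerp O p (a b : R) : lerp O (lerp O p a) b = lerp O p (a * b).
Proof. by rewrite /lerp/=; congr (_, _); ring. Qed.

Lemma lerp1 O p : lerp O p 1 = p.
Proof. by rewrite /lerp [RHS]surjective_pairing; congr (_, _); ring. Qed.

Lemma lerp0 O p : lerp O p 0 = O.
Proof. by rewrite /lerp [RHS]surjective_pairing; congr (_, _); ring. Qed.

Lemma lerp_inj O q (a b : R) : a != b -> lerp O q a = lerp O q b -> q = O.
Proof.
rewrite -subr_eq0 => ab [E1 E2].
rewrite (surjective_pairing q) [RHS]surjective_pairing.
by congr (_, _); apply: (mulfI ab); lra.
Qed.

(** Hence two points of a line that misses [O] are collinear with [O] only if they coincide. *)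
Lemma cross_lerp O X Y s t :
  cross O (lerp X Y s) (lerp X Y t) = (t - s) * cross O X Y.
Proof. by rewrite /cross /lerp/=; ring. Qed.

Lemma cross_lerp_base O X Y s t :
  cross O (lerp O X s) (lerp O Y t) = s * t * cross O X Y.
Proof. by rewrite /cross /lerp/=; ring. Qed.

Lemma cross_self O X : cross O X X = 0.
Proof. by rewrite /cross/=; ring. Qed.

Lemma cross_on_line X Y s : cross (lerp X Y s) X Y = 0.
Proof. by rewrite /cross /lerp/=; ring. Qed.

Lemma star_shrink P O p (l : R) : in_kernel P O -> P p -> 0 <= l <= 1 -> P (lerp O p l).
Proof.
by move=> [_ star] Pp l01; apply: (star _ Pp); exists l => //=; rewrite in_itv.
Qed.

(** Dilation by [l^-1] carries a neighbourhood of the shrunk point into [P], and shrinking by [l]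
    brings it back inside [P]. *)
Lemma star_shrink_interior P O p (l : R) : in_kernel P O -> interior P p ->
  0 < l <= 1 -> interior P (lerp O p l).
Proof.
move=> kP Pp /andP[l0 l1].
have lN0 := lt0r_neq0 l0.
have E : lerp O (lerp O p l) l^-1 = p by rewrite lerp_lerp divff// lerp1.
have := @lerp_endpoint_continuous O l^-1 (lerp O p l) P; rewrite /= E => /(_ Pp) H.
have {}H : \forall y \near lerp O p l, P (lerp O y l^-1) := H.
apply: filterS H => y /= Py.
have -> : y = lerp O (lerp O y l^-1) l by rewrite lerp_lerp mulVf// lerp1.
by apply: star_shrink => //; rewrite (ltW l0).
Qed.

(** Among the [n + 1] points [i / (n + 1)] two share a label. With edges as labels, this finds two
    points on a common edge. *)
Lemma pigeonhole_itv n (Q : R -> 'I_n -> Prop) :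
  (forall s, 0 <= s <= 1 -> exists k, Q s k) ->
  exists s t k, [/\ 0 <= s, s < t, t <= 1, Q s k & Q t k].
Proof.
move=> H.
pose u (i : 'I_n.+1) : R := i%:R / n.+1%:R.
have u01 i : 0 <= u i <= 1.
  by rewrite divr_ge0//= ler_pdivrMr// mul1r ler_nat ltnW.
have [K HK] := choice (fun i => H (u i) (u01 i)).
have : ~ injective K by move=> /leq_card; rewrite !card_ord ltnn.
move=> /existsNP[i /existsNP[j /not_implyP[Kij ij]]].
wlog lij : i j Kij ij / (i < j)%N.
  move=> W; have [/W|/W|/val_inj//] := ltngtP i j; first exact.
  by apply => //; exact/nesym.
exists (u i), (u j), (K i); split.
- by case/andP: (u01 i).
- by rewrite ltr_pM2r ?invr_gt0// ltr_nat.
- by case/andP: (u01 j).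
- exact: HK.
- by rewrite Kij; exact: HK.
Qed.

Lemma compact_closed_plane P : compact P -> closed P.
Proof. by apply: compact_closed; exact: norm_hausdorff. Qed.

Lemma bdry_closedE P : closed P -> bdry P = P `\` interior P.
Proof. by move=> /closure_id PE; rewrite /bdry -PE. Qed.

(** [tau] is the largest parameter for which the ray is in [P]; it exists because the set of such
    parameters is closed and bounded. *)
Lemma ray_exit P O p : compact P -> P p -> p != O ->
  exists2 tau, 1 <= tau & bdry P (lerp O p tau).
Proof.
move=> cP Pp pO; have clP := compact_closed_plane cP.
pose T := [set t : R | P (lerp O p t)].
pose nrm := (p.1 - O.1) ^+ 2 + (p.2 - O.2) ^+ 2.
have nrm0 : 0 < nrm.
  rewrite lt_neqAle addr_ge0 ?sqr_ge0// andbT eq_sym.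
  apply: contra pO; rewrite paddr_eq0 ?sqr_ge0// !sqrf_eq0 !subr_eq0 => /andP[/eqP p1 /eqP p2].
  by apply/eqP; rewrite (surjective_pairing p) p1 p2 -surjective_pairing.
(* The scalar product with [p - O] grows linearly along the ray and is bounded on the compact set
   [P]. *)
pose L q := (p.1 - O.1) * (q.1 - O.1) + (p.2 - O.2) * (q.2 - O.2).
have cL : continuous L.
  have H (a b : R) (g : R * R -> R) : continuous g -> continuous (fun q => a * (g q - b)).
    move=> cg q; apply: cvgM; first exact: cvg_cst.
    by apply: cvgB; [exact: cg|exact: cvg_cst].
  by move=> q; apply: cvgD; apply: H => ?; [exact: cvg_fst|exact: cvg_snd].
have [c _ cmax] := compact_EVT_max (ex_intro _ p Pp) cP (continuous_subspaceT cL).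
have LE t : L (lerp O p t) = t * nrm by rewrite /L /nrm /lerp/=; ring.
have Tub : has_ubound T.
  exists (L c / nrm) => t Tt; rewrite ler_pdivlMr// -LE; apply: cmax.
  by rewrite inE.
have T1 : T 1 by rewrite /T/= lerp1.
have clT : closed T by apply: closed_comp => // t _; exact: lerp_continuous.
have Ts : T (sup T).
  have := closure_sup (ex_intro _ 1 T1) Tub.
  by have /closure_id <- := clT.
exists (sup T); first by apply: ub_le_sup.
rewrite bdry_closedE//; split=> // iP.
have := @lerp_continuous O p (sup T) P iP.
move=> /nbhs_ballP[e/= e0 H].
have B : ball (sup T) e (sup T + e / 2).
  by rewrite /ball/= opprD addNKr normrN gtr0_norm ?divr_gt0//; lra.
by have := ub_le_sup Tub (H _ B); lra.
Qed.

Section nice.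
Variables (n : nat) (A : 'I_n -> R * R) (P : set (R * R)) (O : R * R).
Hypothesis nice : nice_polygon A P O.

Let cP : compact P. Proof. by case: nice => -[_ [? _]]. Qed.
Let kP : in_kernel P O. Proof. by case: nice => _ []. Qed.
Let clP : closed P. Proof. exact: compact_closed_plane. Qed.
Let bdryE : bdry P = poly_curve A. Proof. by case: nice => -[_ [_ []]]. Qed.

Lemma nice_boundary_on_edge p : P p -> ~ interior P p ->
  exists k t, 0 <= t <= 1 /\ p = lerp (A k) (A (ordS k)) t.
Proof.
move=> Pp iP; have : bdry P p by rewrite bdry_closedE.
by rewrite bdryE => -[k _ [t /=]]; rewrite in_itv/= => t01 <-; exists k, t.
Qed.

Lemma nice_edge k t : 0 <= t <= 1 ->
  P (lerp (A k) (A (ordS k)) t) /\ ~ interior P (lerp (A k) (A (ordS k)) t).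
Proof.
move=> t01; have : bdry P (lerp (A k) (A (ordS k)) t).
  by rewrite bdryE; exists k => //; exists t => //=; rewrite in_itv.
by rewrite bdry_closedE.
Qed.

Lemma nice_cross_neq0 k : cross O (A k) (A (ordS k)) != 0.
Proof.
apply/eqP => ck.
have c0 j : cross O (A j) (A (ordS j)) = 0.
  case: nice => _ [_ /(_ j k)]; rewrite !tri_areaE ck normr0 mul0r => /eqP.
  by rewrite mulf_eq0 invr_eq0 pnatr_eq0 orbF normr_eq0 => /eqP.
case: nice => -[_ [_ [[z iz] _]]] _.
move: (iz) => /nbhs_ballP[e/= e0 ze].
(* A horizontal shift inside the ball that leaves the vertical line through [O]. *)
pose d : R := if z.1 == O.1 then e / 2 else 0.
have dO : z.1 + d != O.1.
  rewrite /d; case: ifPn => [/eqP->|]; last by rewrite addr0.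
  by rewrite -subr_eq0 addrAC subrr add0r mulf_neq0// lt0r_neq0.
(* A vertical segment in the ball: distinct points of it lie on distinct lines through [O]. *)
pose p s : R * R := (z.1 + d, z.2 + s * (e / 2)).
have pP s : 0 <= s <= 1 -> P (p s).
  move=> /andP[s0 s1]; apply: ze; split; rewrite /ball/= opprD addNKr normrN.
    by rewrite /d; case: ifP => _; rewrite ?normr0// gtr0_norm ?divr_gt0//; lra.
  by rewrite ger0_norm ?mulr_ge0// ?divr_ge0 ?(ltW e0)//; nra.
have pO s : p s != O.
  by apply: contra dO => /eqP <-.
have H s : 0 <= s <= 1 -> exists k, exists tau t,
    1 <= tau /\ lerp O (p s) tau = lerp (A k) (A (ordS k)) t.
  move=> s01; have [tau tau1] := ray_exit cP (pP s s01) (pO s).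
  rewrite bdry_closedE// => -[? /nice_boundary_on_edge[//|j [t [_ E]]]].
  by exists j, tau, t.
have [s [t [j [_ st _ [a [x [a1 aE]]] [b [y [b1 bE]]]]]]] := pigeonhole_itv H.
(* Two rays exit through the same edge, whose points are all collinear with [O]; but the rays
   themselves are not collinear. *)
have : cross O (lerp O (p s) a) (lerp O (p t) b) == 0 by rewrite aE bE cross_lerp c0 mulr0.
rewrite cross_lerp_base.
have -> : cross O (p s) (p t) = (z.1 + d - O.1) * ((t - s) * (e / 2)).
  by rewrite /cross/p/=; ring.
rewrite !mulf_eq0 !subr_eq0 (negbTE dO) (gt_eqF st) invr_eq0 pnatr_eq0 (gt_eqF e0) !orbF.
by rewrite !gt_eqF//; lra.
Qed.

Lemma nice_edge_neq_center k t : lerp (A k) (A (ordS k)) t != O.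
Proof.
by apply/eqP => E; have := nice_cross_neq0 k; rewrite -E cross_on_line eqxx.
Qed.

(* Otherwise a whole radial segment would lie on the boundary, hence two of
   its points on one edge, whose line would then pass through [O]. *)
Lemma nice_beyond_edge k t (m : R) : 0 <= t <= 1 -> 1 < m ->
  ~ P (lerp O (lerp (A k) (A (ordS k)) t) m).
Proof.
move=> t01 m1; set q := lerp (A k) _ t => Pm.
have [_ nq] := nice_edge k t01; rewrite -/q in nq.
(* The ratios from 1 to [m]; every such point of the ray will turn out to be on the boundary. *)
pose r s : R := 1 + s * (m - 1).
have r0 s : 0 <= s -> 0 < r s by move=> s0; rewrite /r; nra.
have H s : 0 <= s <= 1 -> exists j, exists x,
    lerp O q (r s) = lerp (A j) (A (ordS j)) x.
  move=> /andP[s0 s1].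
  have m0 : 0 < m by lra.
  have := r0 s s0 => rs0.
  have [|ni|j [x [_ E]]] := @nice_boundary_on_edge (lerp O q (r s)).
  - have -> : lerp O q (r s) = lerp O (lerp O q m) (r s / m).
      by rewrite lerp_lerp mulrC divfK// lt0r_neq0.
    apply: star_shrink => //; rewrite divr_ge0 ?(ltW m0) ?(ltW rs0)//=.
    by rewrite ler_pdivrMr// mul1r /r; nra.
  (* If the point at ratio [r s] were interior, so would be its shrunk copy [q]. *)
  - apply: nq; rewrite -(lerp1 O q) -(divff (lt0r_neq0 rs0)) -lerp_lerp.
    apply: star_shrink_interior => //; rewrite invr_gt0 rs0/= invf_le1// /r; nra.
  - by exists j, x.
have [s [u [j [s0 su _ [x xE] [y yE]]]]] := pigeonhole_itv H.
have : cross O (lerp O q (r s)) (lerp O q (r u)) == 0.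
  by rewrite cross_lerp_base cross_self mulr0.
rewrite xE yE cross_lerp mulf_eq0 (negbTE (nice_cross_neq0 j)) orbF subr_eq0 => /eqP yx.
move: (nice_edge_neq_center k t); rewrite -/q => /eqP; apply.
have : lerp O q (r s) = lerp O q (r u) by rewrite xE yE yx.
have ru : r s - r u != 0.
  have -> : r s - r u = (s - u) * (m - 1) by rewrite /r; ring.
  by rewrite mulf_neq0// subr_eq0 ?(lt_eqF su) ?(gt_eqF m1).
by apply: lerp_inj; rewrite -subr_eq0.
Qed.

Lemma nice_decomposition :
  P `\ O = \bigcup_(k in [set: 'I_n]) half_tri O (A k) (A (ordS k)).
Proof.
apply/seteqP; split => p.
- move=> [Pp /eqP pO].
  have [tau tau1] := ray_exit cP Pp pO.
  rewrite bdry_closedE// => -[Pt /nice_boundary_on_edge[//|k [t [/andP[t0 t1] E]]]].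
  have tau0 : 0 < tau by lra.
  have pE : p = lerp O (lerp O p tau) tau^-1.
    by rewrite lerp_lerp divff ?lerp1// lt0r_neq0.
  have ti0 : tau^-1 != 0 by rewrite invr_eq0 lt0r_neq0.
  have ti1 : tau^-1 \in `]0, 1] by rewrite in_itv/= invr_gt0 tau0/= invf_le1.
  rewrite pE E.
  (* A ray through the far vertex of edge [k] is not in its half-open triangle; it belongs to the
     next one, with parameter 0. *)
  have [t11|tn1] := eqVneq t 1.
    have z01 : (0 : R) \in `[0, 1[ by rewrite in_itv/= lexx ltr01.
    have := (half_tri_lerp_iff 0 (nice_cross_neq0 (ordS k)) ti0).2 (conj ti1 z01).
    rewrite lerp0 => h; exists (ordS k) => //.
    by rewrite t11 lerp1.
  exists k => //; apply: (half_tri_lerp_iff t (nice_cross_neq0 k) ti0).2.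
  by split=> //; rewrite in_itv/= t0 lt_neqAle tn1.
- move=> [k _ /(half_tri_decomp (nice_cross_neq0 k))[t [w [/andP[t0 t1] /andP[w0 w1] ->]]]].
  have t01 : 0 <= t <= 1 by rewrite t0 ltW.
  have [Pe _] := nice_edge k t01.
  split; first by apply: star_shrink => //; rewrite ltW.
  move=> E; have /eqP := nice_edge_neq_center k t; apply.
  rewrite -(lerp1 O (lerp _ _ t)) -(divff (lt0r_neq0 w0)) -lerp_lerp E.
  by rewrite /lerp !subrr !mulr0 !addr0 -surjective_pairing.
Qed.

(** A common point defines a single ray, whose intersections with both edges agree: otherwise one
    would lie beyond the other. Simplicity of the polygon then rules out distinct edges. *)
Lemma nice_trivIset :
  trivIset [set: 'I_n] (fun k => half_tri O (A k) (A (ordS k))).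
Proof.
move=> i j _ _ [p [pi pj]].
have [t [w [/andP[t0 t1] /andP[w0 w1] pE]]] := half_tri_decomp (nice_cross_neq0 i) pi.
have [u [v [/andP[u0 u1] /andP[v0 v1] pE']]] := half_tri_decomp (nice_cross_neq0 j) pj.
have t01 : 0 <= t <= 1 by rewrite t0 ltW.
have u01 : 0 <= u <= 1 by rewrite u0 ltW.
set q := lerp (A i) _ t in pE; set q' := lerp (A j) _ u in pE'.
have qE : q = lerp O q' (v / w).
  by rewrite -lerp_lerp -pE' pE lerp_lerp divff ?lerp1// lt0r_neq0.
have qE' : q' = lerp O q (w / v).
  by rewrite -lerp_lerp -pE pE' lerp_lerp divff ?lerp1// lt0r_neq0.
have qq : q = q'.
  have [vw|wv|vw] := ltgtP v w.
  - exfalso; apply: (@nice_beyond_edge i t (w / v)) => //.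
      by rewrite ltr_pdivlMr// mul1r.
    by rewrite -/q -qE'; case: (nice_edge j u01).
  - exfalso; apply: (@nice_beyond_edge j u (v / w)) => //.
      by rewrite ltr_pdivlMr// mul1r.
    by rewrite -/q' -qE; case: (nice_edge i t01).
  - by rewrite qE vw divff ?lerp1// lt0r_neq0.
have [//|ij] := eqVneq i j; exfalso.
(* Simplicity leaves only the far end of one of the two edges as a common point, but half-open
   triangles use parameters below 1. *)
have end_ k x : x < 1 -> lerp (A k) (A (ordS k)) x <> A (ordS k).
  move=> x1 E; have := nice_cross_neq0 k.
  have : cross O (lerp (A k) (A (ordS k)) x) (lerp (A k) (A (ordS k)) 1) == 0.
    by rewrite lerp1 E cross_self.
  by rewrite cross_lerp mulf_eq0 subr_eq0 gt_eqF//= => ->.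
case: nice => -[[_ simple] _] _.
have [||[ijS qA]|[jiS qA]] := simple i j ij q.
- by exists t => //=; rewrite in_itv.
- by rewrite qq; exists u => //=; rewrite in_itv.
- by apply: (end_ i t t1); rewrite -/q -ijS.
- by apply: (end_ j u u1); rewrite -/q' -qq -jiS.
Qed.

End nice.
End geometry.

(** * Averages over a nice polygon *)

Section average.
Context {R : realType}.
Local Notation mu := (@lebesgue_measure R).
Implicit Types (X Y Z O p q : R * R) (f : R * R -> R).

Lemma tri_swap X Y Z : tri X Y Z = tri X Z Y.
Proof.
have H A B C : tri A B C `<=` tri A C B.
  move=> p [a [b [c [a0 b0 c0 abc ->]]]]; exists a, c, b; split=> //; first lra.
  by congr (_, _); ring.
by apply/seteqP; split; exact: H.
Qed.

(** The upper half of the Hermite-Hadamard inequality. *)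
Lemma avg_seg_le_endpoints X Y Z f : cross X Y Z != 0 -> convex_on (tri X Y Z) f ->
  avg_seg f Y Z <= (f Y + f Z) / 2.
Proof.
move=> det0 cf.
have YZ t : 0 <= t <= 1 -> tri X Y Z (lerp Y Z t) by exact: tri_edge.
(* Subtracting [f Y] leaves the bound [t (f Z - f Y)], which has no constant term. *)
have cg : convex_on (tri X Y Z) (fun p => f p + - f Y).
  by move=> x y Tx Ty t t01; have := cf x y Tx Ty t t01; lra.
have -> : (f Y + f Z) / 2 = ((f Z - f Y) / 2 + 0 / 3) + f Y by field.
rewrite -lerBlDr -avg_segD; last exact: (integrable_convex_lerp det0 cf).
rewrite -Rintegral_unit_itv_quadratic; apply: le_Rintegral.
- exact: measurable_itv.
- exact: (integrable_convex_lerp det0 cg).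
- apply: integrable_unit_itv_continuous; exact: quadratic_continuous.
- move=> t /=; rewrite in_itv/= => t01; have := convex_tri_edge cf t01; lra.
Qed.

Lemma set1_setX p : [set p] = [set p.1] `*` [set p.2].
Proof.
apply/seteqP; split => [q ->//|q [/= q1 q2]].
by rewrite /= (surjective_pairing q) q1 q2 -surjective_pairing.
Qed.

Lemma leb2_set1 p : leb2 [set p] = 0%E.
Proof.
by rewrite set1_setX /leb2 product_measure1E//= lebesgue_measure_set1 mul0e.
Qed.

Lemma measurable_set1_plane p : measurable [set p].
Proof.
by rewrite set1_setX; apply: measurableX; exact: measurable_set1.
Qed.

Lemma measurable_fun_bigsetU (I : Type) (s : seq I) (F : I -> set (R * R)) f :
  (forall i, measurable (F i)) -> (forall i, measurable_fun (F i) f) ->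
  measurable_fun (\big[setU/set0]_(i <- s) F i) f.
Proof.
move=> mF mf; elim: s => [|i s IH]; first by rewrite big_nil; exact: measurable_fun_set0.
by rewrite big_cons; apply/measurable_funU => //; exact: bigsetU_measurable.
Qed.

Section nice.
Variables (n : nat) (A : 'I_n -> R * R) (P : set (R * R)) (O : R * R).
Hypothesis nice : nice_polygon A P O.

Let T k := tri O (A k) (A (ordS k)).
Let H k := half_tri O (A k) (A (ordS k)).

Lemma nice_setU1 : P = (P `\ O) `|` [set O].
Proof. by rewrite setUC setD1K//; case: nice => _ [[]]. Qed.

Lemma measurable_nice_setD1 : measurable (P `\ O).
Proof.
rewrite (nice_decomposition nice); apply: fin_bigcup_measurable => // k _.
exact: measurable_half_tri.
Qed.

(** The center is a null set and the half-open triangles partition the rest; each may then be closed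
    up without changing its integral. *)
Lemma nice_Rintegral f : (forall k, convex_on (T k) f) ->
  Rintegral (@leb2 R) P f = \sum_k Rintegral (@leb2 R) (T k) f.
Proof.
move=> cf.
have det0 := nice_cross_neq0 nice.
have mf k : measurable_fun (H k) f.
  apply: measurable_funS (convex_tri_measurable (det0 k) (cf k)).
    exact: measurable_tri.
  exact: half_tri_sub.
have mH k : measurable (H k) by exact: measurable_half_tri.
have fH k : (@leb2 R).-integrable (H k) (EFin \o f).
  apply: integrableS (integrable_convex_tri (det0 k) (cf k)).
  - exact: measurable_tri.
  - exact: measurable_half_tri.
  - exact: half_tri_sub.
have DE : P `\ O = \big[setU/set0]_(k < n) H k.
  rewrite (nice_decomposition nice) -bigcup_seq; apply: eq_bigcupl.
  by split=> k _ //=; rewrite mem_index_enum.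
have mD := measurable_nice_setD1.
have mfD : measurable_fun (P `\ O) f by rewrite DE; exact: measurable_fun_bigsetU.
have mO : measurable [set O] by exact: measurable_set1_plane.
have mfO : measurable_fun [set O] f by exact: measurable_fun_set1.
have mfU : measurable_fun ((P `\ O) `|` [set O]) (EFin \o f).
  by apply/measurable_EFinP/measurable_funU.
rewrite /Rintegral [in LHS]nice_setU1 integral_setU; last 4 first.
- exact: mD.
- exact: mO.
- exact: mfU.
- by apply/disj_setPS => p [[_ pO] /= ].
rewrite [X in fine (_ + X)%E](_ : _ = 0%E); last first.
  apply: null_set_integral; [exact: mO| |exact: leb2_set1].
  exact/measurable_EFinP.
rewrite adde0 DE integral_bigsetU_EFin; last 4 first.
- exact: mH.
- exact: index_enum_uniq.
- exact: sub_trivIset (nice_trivIset nice).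
- by rewrite -DE; exact/measurable_EFinP.
rewrite (eq_bigr (fun k => (Rintegral (@leb2 R) (H k) f)%:E)); last first.
  by move=> k _; rewrite /Rintegral fineK//; apply: integrable_fin_num; [exact: mH|exact: fH].
rewrite sumEFin /=; apply: eq_bigr => k _; exact: (Rintegral_half_tri (det0 k) (cf k)).
Qed.

Lemma nice_n_gt0 : (0 < n)%N.
Proof. by case: nice => -[[]] /ltnW /ltnW. Qed.

Lemma nice_area : exists2 s, 0 < s & forall k, tri_area O (A k) (A (ordS k)) = s.
Proof.
pose k0 := Ordinal nice_n_gt0.
exists (tri_area O (A k0) (A (ordS k0))).
  by rewrite tri_areaE divr_gt0// normr_gt0; exact: (nice_cross_neq0 nice k0).
by move=> k; case: nice => _ [_]; exact.
Qed.

Lemma nice_avg2 f : (forall k, convex_on (T k) f) ->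
  avg2 f P = n%:R^-1 *
    \sum_k (Rintegral (@leb2 R) (T k) f / tri_area O (A k) (A (ordS k))).
Proof.
move=> cf; have [s s0 sE] := nice_area.
have det0 := nice_cross_neq0 nice.
have mP : measurable P.
  by rewrite nice_setU1; apply: measurableU; [exact: measurable_nice_setD1|exact: measurable_set1_plane].
(* The area is the integral of the constant 1, which is convex on each triangle. *)
have aP : fine (leb2 P) = n%:R * s.
  have c1 k : convex_on (T k) (cst 1 : R * R -> R).
    by move=> x y _ _ t _ /=; rewrite !mulr1 subrK.
  have := nice_Rintegral c1; rewrite Rintegral_cst// mul1r => ->.
  rewrite (eq_bigr (fun=> s)); first by rewrite sumr_const card_ord mulr_natl.
  move=> k _; rewrite Rintegral_cst ?mul1r; last exact: measurable_tri.
  by rewrite /= (leb2_tri_half (det0 k)).1 /= sE.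
rewrite /avg2 aP nice_Rintegral// invfM mulrCA mulr_suml.
by congr (_ * _); apply: eq_bigr => k _; rewrite sE.
Qed.

End nice.
End average.

Theorem theorem4p1 (R : realType) (n : nat) (A : 'I_n -> (R * R)%type) (P : set ((R * R)%type))
  (O : (R * R)%type) (f : (R * R)%type -> R) :
  nice_polygon A P O ->
  (forall k : 'I_n, convex_on (tri O (A k) (A (ordS k))) f) ->
  [/\ avg2 f P <= 3^-1 * f O
        + 2 / 3 * (n%:R^-1 * \sum_(k < n) avg_seg f (A k) (A (ordS k))),
      avg2 f P <= 3^-1 * (n%:R^-1 * \sum_(k < n) f (A k))
        + 2 / 3 * (n%:R^-1 * \sum_(k < n) avg_seg f O (A k)),
      avg2 f P <= 3^-1 * f O + 2 / 3 * (n%:R^-1 * \sum_(k < n) f (A k))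
    & n%:R^-1 * \sum_(k < n)
          avg_seg f (homothety O (2 / 3) (A k)) (homothety O (2 / 3) (A (ordS k)))
        <= avg2 f P].
Proof.
move=> nice cf.
have [s s0 sE] := nice_area nice.
have det0 := nice_cross_neq0 nice.
have n0 : 0 < n%:R :> R by rewrite ltr0n; exact: nice_n_gt0 nice.
rewrite (nice_avg2 nice cf).
set I := fun k => Rintegral (@leb2 R) (tri O (A k) (A (ordS k))) f.
pose a k := avg_seg f (A k) (A (ordS k)).
pose v k := avg_seg f O (A k).
have avg_le (F G : 'I_n -> R) : (forall k, F k <= G k) ->
    n%:R^-1 * \sum_k F k <= n%:R^-1 * \sum_k G k.
  by move=> FG; rewrite ler_wpM2l ?invr_ge0 ?(ltW n0)//; exact: ler_sum.
have avgD (x y : R) (F G : 'I_n -> R) :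
    n%:R^-1 * \sum_k (x * F k + y * G k) =
    x * (n%:R^-1 * \sum_k F k) + y * (n%:R^-1 * \sum_k G k).
  by rewrite big_split/= -!mulr_sumr; ring.
have avg_cst (c : R) : n%:R^-1 * \sum_(k < n) c = c.
  by rewrite sumr_const card_ord -[c *+ n]mulr_natl mulrA mulVf ?mul1r// lt0r_neq0.
(* Cyclic reindexing: [ordS] is a permutation of the indices. *)
have avg_shift (F : 'I_n -> R) : \sum_k F (ordS k) = \sum_k F k.
  by rewrite [RHS](reindex_inj (@ordS_inj n)).
have I_le k : I k / s <= 3^-1 * f O + 2 / 3 * a k.
  have /andP[_] := tri_bounds (det0 k) (cf k).
  by rewrite sE ler_pdivrMr// mulrC [f O / 3]mulrC.
(* Apex [A k]: the opposite side is the radius to the next vertex. *)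
have I_le1 k : I k / s <= 3^-1 * f (A k) + 2 / 3 * v (ordS k).
  have E : tri O (A k) (A (ordS k)) = tri (A k) O (A (ordS k)).
    by rewrite tri_rotate tri_swap.
  have cE : cross (A k) O (A (ordS k)) = - cross O (A k) (A (ordS k)) by rewrite /cross; ring.
  have d0 : cross (A k) O (A (ordS k)) != 0 by rewrite cE oppr_eq0.
  have cf' := cf k; rewrite E in cf'.
  have /andP[_] := tri_bounds d0 cf'.
  rewrite -E tri_areaE cE normrN -tri_areaE sE ler_pdivrMr//.
  by rewrite mulrC [f (A k) / 3]mulrC.
(* Apex [A (ordS k)]: the opposite side is the radius to [A k]. *)
have I_le2 k : I k / s <= 3^-1 * f (A (ordS k)) + 2 / 3 * v k.
  have E : tri O (A k) (A (ordS k)) = tri (A (ordS k)) O (A k) by rewrite tri_rotate tri_rotate.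
  have cE : cross (A (ordS k)) O (A k) = cross O (A k) (A (ordS k)) by rewrite /cross; ring.
  have d0 : cross (A (ordS k)) O (A k) != 0 by rewrite cE.
  have cf' := cf k; rewrite E in cf'.
  have /andP[_] := tri_bounds d0 cf'.
  rewrite -E tri_areaE cE -tri_areaE sE ler_pdivrMr//.
  by rewrite mulrC [f (A (ordS k)) / 3]mulrC.
have a_le k : a k <= 2^-1 * f (A k) + 2^-1 * f (A (ordS k)).
  by have := avg_seg_le_endpoints (det0 k) (cf k); rewrite -/(a k); lra.
have SE : \sum_k (I k / tri_area O (A k) (A (ordS k))) = \sum_k (I k / s).
  by apply: eq_bigr => k _; rewrite sE.
rewrite SE; split.
- apply: (le_trans (avg_le _ _ I_le)).
  by rewrite (avgD _ _ (fun=> f O) a) avg_cst.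
(* The mean of the two bounds; in the cyclic sum each vertex and each radius then occurs twice with
   weight one half. *)
- have I_le3 k : I k / s <= 3^-1 * (2^-1 * f (A k) + 2^-1 * f (A (ordS k)))
      + 2 / 3 * (2^-1 * v k + 2^-1 * v (ordS k)).
    by have := I_le1 k; have := I_le2 k; lra.
  apply: (le_trans (avg_le _ _ I_le3)).
  rewrite (avgD _ _ (fun k => 2^-1 * f (A k) + 2^-1 * f (A (ordS k)))
    (fun k => 2^-1 * v k + 2^-1 * v (ordS k))).
  rewrite (avgD _ _ (f \o A) (fun k => f (A (ordS k)))) (avgD _ _ v (fun k => v (ordS k))).
  by rewrite (avg_shift (f \o A)) (avg_shift v) /=; lra.
- have I_le4 k : I k / s <= 3^-1 * f O + 2 / 3 * (2^-1 * f (A k) + 2^-1 * f (A (ordS k))).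
    by have := I_le k; have := a_le k; lra.
  apply: (le_trans (avg_le _ _ I_le4)).
  rewrite (avgD _ _ (fun=> f O) (fun k => 2^-1 * f (A k) + 2^-1 * f (A (ordS k)))).
  rewrite avg_cst (avgD _ _ (f \o A) (fun k => f (A (ordS k)))).
  by rewrite (avg_shift (f \o A)) /=; lra.
- apply: avg_le => k.
  have /andP[+ _] := tri_bounds (det0 k) (cf k).
  by rewrite sE ler_pdivlMr// mulrC.
Qed.
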